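(* Let $k\geq 2$ and $m\geq 3$ be integers, and let $n$ be an integer such that $n\geq 2m+1$ if $m\in\{3,4,5\}$, and $n\geq (4m-1)(m-1)+1$ if $m\geq 6$. Then $R(kP_n,J_{2m})=kn+m-1$.
   Context: All graphs are finite and simple. For graphs $G$ and $H$, the Ramsey number $R(G,H)$ is the least natural number $N$ such that for every graph $F$ on $N$ vertices, either $F$ contains $G$ as a subgraph or the complement $\overline{F}$ contains $H$ as a subgraph. $P_n$ denotes the path on $n$ vertices, and $kP_n$ denotes the disjoint union of $k$ copies of $P_n$. For $m\geq 2$, the Jahangir graph $J_{2m}$ is the graph consisting of a cycle $C_{2m}$ together with one additional vertex adjacent to $m$ alternate vertices of $C_{2m}$ (so $J_{2m}$ has $2m+1$ vertices). *)

(* Defs.v *)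
From mathcomp Require Import all_boot.

Set Implicit Arguments.
Unset Strict Implicit.
Unset Printing Implicit Defensive.

Record sgraph := SGraph {
  vertex :> finType;
  adj : rel vertex;
  adj_sym : symmetric adj;
  adj_irrefl : irreflexive adj
}.

(* The simple graph underlying an arbitrary relation: directions and loops
   are forgotten. *)
Definition simple_rel (T : finType) (e : rel T) : rel T :=
  fun x y => (x != y) && (e x y || e y x).

Lemma simple_rel_sym (T : finType) (e : rel T) : symmetric (simple_rel e).
Proof. by move=> x y; rewrite /simple_rel eq_sym orbC. Qed.

Lemma simple_rel_irrefl (T : finType) (e : rel T) : irreflexive (simple_rel e).
Proof. by move=> x; rewrite /simple_rel eqxx. Qed.

Definition graph_of_rel (T : finType) (e : rel T) : sgraph :=
  SGraph (simple_rel_sym e) (simple_rel_irrefl e).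

Definition compl_adj (G : sgraph) : rel G :=
  fun x y => (x != y) && ~~ adj x y.

Lemma compl_adj_sym (G : sgraph) : symmetric (@compl_adj G).
Proof. by move=> x y; rewrite /compl_adj eq_sym adj_sym. Qed.

Lemma compl_adj_irrefl (G : sgraph) : irreflexive (@compl_adj G).
Proof. by move=> x; rewrite /compl_adj eqxx. Qed.

Definition complement (G : sgraph) : sgraph :=
  SGraph (@compl_adj_sym G) (@compl_adj_irrefl G).

Definition copies_adj (k : nat) (G : sgraph) : rel ('I_k * G) :=
  fun u v => (u.1 == v.1) && adj u.2 v.2.

Lemma copies_adj_sym k (G : sgraph) : symmetric (@copies_adj k G).
Proof. by move=> u v; rewrite /copies_adj eq_sym adj_sym. Qed.

Lemma copies_adj_irrefl k (G : sgraph) : irreflexive (@copies_adj k G).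
Proof. by move=> u; rewrite /copies_adj adj_irrefl andbF. Qed.

(* Vertex (i, x) is the vertex x of the i-th copy of G. *)
Definition copies (k : nat) (G : sgraph) : sgraph :=
  SGraph (@copies_adj_sym k G) (@copies_adj_irrefl k G).

Definition path_graph (n : nat) : sgraph :=
  graph_of_rel (fun i j : 'I_n => i.+1 == j :> nat).

(* ordS is the cyclic successor; this is the cycle C_n for n >= 3. *)
Definition cycle_graph (n : nat) : sgraph :=
  graph_of_rel (fun i j : 'I_n => ordS i == j).

(* The graph J_{2m} (note the argument m): Some i is the vertex i of C_{2m},
   and None is the additional vertex, joined to the m even vertices. *)
Definition jahangir_rel (m : nat) : rel (option (cycle_graph (2 * m))) :=
  fun u v =>
    match u, v with
    | Some i, Some j => adj i j
    | None, Some i => ~~ odd (i : 'I_(2 * m))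
    | _, None => false
    end.

Definition jahangir (m : nat) : sgraph := graph_of_rel (@jahangir_rel m).

(* G is isomorphic to a (not necessarily induced) subgraph of F. *)
Definition contains (F G : sgraph) : Prop :=
  exists2 f : G -> F, injective f & forall x y, adj x y -> adj (f x) (f y).

Definition ramsey_property (G H : sgraph) (N : nat) : Prop :=
  forall F : sgraph, #|F| = N -> contains F G \/ contains (complement F) H.

(* R(G, H) = N, i.e. N is the least natural number with the Ramsey property;
   in particular such a number exists. *)
Definition is_ramsey_number (G H : sgraph) (N : nat) : Prop :=
  ramsey_property G H N /\ forall M, ramsey_property G H M -> N <= M.

(* Main.v *)
Require Import Defs.
From mathcomp Require Import all_boot zify.

(* For the upper bound, k - 1 paths are removed greedily, so it suffices that a
   graph F on n + m - 1 vertices contains P_n or its complement contains J_2m.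
   Let P be a longest path of F, with p < n vertices, and Q the set of vertices
   off P.  If |Q| >= 2m, depth-first search gives disjoint sets of m and m + 1
   vertices without edges in between.  Otherwise we look for a cycle of the
   complement that alternates between m vertices of Q and vertices of P, with
   the first vertex of P as hub: the ends of P are adjacent to no x in Q, no x
   is adjacent to two consecutive vertices of P, and no other vertex of Q is
   adjacent to two successors of neighbours of x.  If every x has few
   neighbours on P, the cycle comes from a Jackson-type theorem on bipartite
   graphs, proved by inserting vertices into a cycle; if some x has many, their
   successors form a set that is almost completely nonadjacent to Q.  This
   settles p >= 2m - 1.  For p < 2m - 1 (which forces m <= 5) some vertices of Q
   without edges to the chosen m serve as additional vertices of the cycle.
   For the lower bound, take two disjoint cliques on kn - 1 and m - 1 vertices. *)

Set Implicit Arguments.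
Unset Strict Implicit.
Unset Printing Implicit Defensive.

(** * Alternating cycles *)

Section AlternatingCycles.

Variables (T : finType) (e : rel T).
Hypothesis e_sym : symmetric e.

Definition alternating (A : {set T}) : rel T :=
  fun a b => e a b && ((a \in A) != (b \in A)).

Definition alt_cycle (A B : {set T}) (c : seq T) : bool :=
  [&& uniq c, cycle (alternating A) c & all (mem (A :|: B)) c].

Lemma alternating_sym A : symmetric (alternating A).
Proof. by move=> a b; rewrite /alternating e_sym eq_sym. Qed.

Lemma alternating_path_count A x s :
  path (alternating A) x s ->
  count (mem A) (x :: s) = (if x \in A then uphalf (size s).+1 else (size s).+1./2).
Proof.
elim: s x => [|y s IHs] x /=; first by move=> _; case: (x \in A).
case/andP=> /andP[_ xy] /IHs /= ->; move: xy.
by case: (x \in A); case: (y \in A) => //= _; rewrite ?uphalf_half; lia.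
Qed.

Lemma alternating_path_nth A x s i :
  path (alternating A) x s -> i < (size s).+1 ->
  (nth x (x :: s) i \in A) = (x \in A) (+) odd i.
Proof.
move=> xs; elim: i => [|i IHi] li; first by rewrite addbF.
have /pathP-/(_ x i li)/andP[_] := xs.
by rewrite IHi ?(ltnW li) //=; case: (x \in A); case: (odd i); case: (_ \in A).
Qed.

Lemma alt_cycle_size A c : cycle (alternating A) c -> size c = 2 * count (mem A) c.
Proof.
case: c => [|x s] // xs; have := xs; rewrite /= rcons_path => /andP[ps /andP[_ lx]].
have := alternating_path_count ps; rewrite /= => ->.
have := alternating_path_nth ps (ltnSn (size s)).
rewrite -last_nth /= in lx *; move=> E; move: lx; rewrite E.
by case: (x \in A); case os: (odd (size s)) => //= _; rewrite ?uphalf_half; lia.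
Qed.

Lemma alt_cycle_rot A B n c : alt_cycle A B (rot n c) = alt_cycle A B c.
Proof.
rewrite /alt_cycle rot_uniq rot_cycle; congr [&& _, _ & _].
by apply: eq_all_r => z; rewrite mem_rot.
Qed.

Lemma alt_cycle_rev A B c : alt_cycle A B (rev c) = alt_cycle A B c.
Proof.
rewrite /alt_cycle rev_uniq rev_cycle all_rev; congr [&& _, _ & _].
by apply: eq_cycle => a b; rewrite alternating_sym.
Qed.

(** The edge from [y] to its successor is replaced by the detour [y], [x], [y'], [next c y]. *)
Lemma alt_cycle_insert A B c x y y' :
  alt_cycle A B c -> x \in A -> x \notin c -> y \in c -> y \notin A ->
  y' \in B -> y' \notin A -> y' \notin c ->
  e x y -> e x y' -> e y' (next c y) ->
  exists2 c', alt_cycle A B c' & c' =i x :: y' :: c.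
Proof.
move=> gc xA xc yc yA y'B y'A y'c exy exy' en.
have [i c' rc] := rot_to yc.
have uc : uniq c by case/and3P: gc.
move: gc en; rewrite -(alt_cycle_rot _ _ i) -(next_rot i uc) rc.
rewrite next_nth mem_head /= eqxx => /and3P[/= /andP[yc' uc'] cyc /andP[yAB c'AB]] en.
have mc z : (z \in c) = (z == y) || (z \in c') by rewrite -(mem_rot i) rc inE.
move: xc y'c; rewrite !mc !negb_or => /andP[xy xc] /andP[y'y y'c].
exists [:: y, x, y' & c']; last by move=> z; rewrite !inE mc; case: (z == y); rewrite ?orbT.
apply/and3P; split.
- rewrite /= !inE !negb_or eq_sym xy eq_sym y'y yc' xc y'c uc' !andbT /=.
  by apply: contraNneq y'A => <-.
- rewrite /= /alternating e_sym exy exy' xA (negbTE yA) (negbTE y'A) /=.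
  case: c' cyc en {rc uc c'AB mc yc' uc' xc y'c} => [|h c'] /=.
    by rewrite /alternating eqxx andbF.
  by case/andP=> /andP[_]; rewrite (negbTE yA) (negbTE y'A) => -> -> ->.
by rewrite /= !inE in yAB *; rewrite yAB xA y'B orbT.
Qed.

Lemma alt_cycle_insert_prev A B c x y y' :
  alt_cycle A B c -> x \in A -> x \notin c -> y \in c -> y \notin A ->
  y' \in B -> y' \notin A -> y' \notin c ->
  e x y -> e x y' -> e y' (prev c y) ->
  exists2 c', alt_cycle A B c' & c' =i x :: y' :: c.
Proof.
move=> gc xA xc yc yA y'B y'A y'c exy exy' en.
have uc : uniq c by case/and3P: gc.
have [] := @alt_cycle_insert A B (rev c) x y y'; rewrite ?alt_cycle_rev ?mem_rev //.
  by rewrite next_rev.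
by move=> c' gc' mc'; exists c' => // z; rewrite mc' !inE mem_rev.
Qed.

(** The edges leaving [y1] and [y2] are dropped. The new cycle runs from [x] to [y1], backwards
    along [c] to [next c y2], over [y'] to [next c y1], then forwards to [y2] and back to [x]. *)
Lemma alt_cycle_cross A B c x y1 y2 y' :
  alt_cycle A B c -> x \in A -> x \notin c ->
  y1 \in c -> y1 \notin A -> y2 \in c -> y2 \notin A -> y1 != y2 ->
  y' \in B -> y' \notin A -> y' \notin c ->
  e x y1 -> e x y2 -> e y' (next c y1) -> e y' (next c y2) ->
  exists2 c', alt_cycle A B c' & c' =i x :: y' :: c.
Proof.
move=> gc xA xc y1c y1A y2c y2A y12 y'B y'A y'c e1 e2.
have [i c1 rc] := rot_to y1c.
have uc : uniq c by case/and3P: gc.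
have gr : alt_cycle A B (y1 :: c1) by rewrite -rc alt_cycle_rot.
have y2c1 : y2 \in c1 by move: y2c; rewrite -(mem_rot i) rc inE eq_sym (negbTE y12).
rewrite -!(next_rot i uc) rc !next_nth mem_head inE y2c1 orbT /= eqxx (negbTE y12).
have mc z : (z \in c) = (z == y1) || (z \in c1) by rewrite -(mem_rot i) rc inE.
move: xc y'c; rewrite !mc !negb_or => /andP[xy1 xc] /andP[y'y1 y'c].
have ucc : uniq (y1 :: c1) by case/and3P: gr.
case/splitPr: y2c1 rc gr xc y'c ucc mc => p1 p2 rc gr xc y'c ucc mc.
have y2p1 : y2 \notin p1.
  by move: ucc; rewrite /= cat_uniq /= negb_or => /and5P[_ _ /andP[]].
rewrite index_cat (negbTE y2p1) /= eqxx addn0 => en1.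
rewrite nth_cat ltnNge leqnSn /= subSnn /= => en2.
have mz : x :: y1 :: rev p2 ++ y' :: rcons p1 y2 =i x :: y' :: c.
  move=> z; rewrite !inE mc !mem_cat mem_rev !inE mem_rcons !inE.
  by case: (z == y1); case: (z == y2); case: (z \in p1); case: (z \in p2); rewrite ?orbT ?orbF.
exists (x :: y1 :: rev p2 ++ y' :: rcons p1 y2).
  apply/and3P; split.
  - have : perm_eq (x :: y1 :: rev p2 ++ y' :: rcons p1 y2)
                   (x :: y' :: y1 :: p1 ++ y2 :: p2).
      apply/permP=> a; rewrite /= !count_cat /= count_rev -cats1 count_cat /=.
      move: (nat_of_bool (a x)) (nat_of_bool (a y1)) (nat_of_bool (a y2)) (nat_of_bool (a y')).
      by move: (count a p1) (count a p2); clear; lia.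
    move/perm_uniq => ->; rewrite [uniq _]/= in ucc.
    rewrite !cons_uniq ucc andbT !inE (negbTE xc) (negbTE y'c) (negbTE xy1) (negbTE y'y1) orbF !andbT.
    by rewrite ?andbT ?orbF; apply: contraNneq y'A => <-.
  - case/and3P: gr => _ + _.
    rewrite /= rcons_cat cat_path /= => /andP[P1 /andP[ly2 P2]].
    have P2r : path (alternating A) y1 (rcons (rev p2) y2).
      have := rev_path (alternating A) y2 (rcons p2 y1).
      rewrite last_rcons belast_rcons rev_cons => ->.
      by rewrite (eq_path (e' := alternating A)) // => u v; exact: alternating_sym.
    have hA : last y1 (rev p2) \in A.
      by move: P2r; rewrite rcons_path /alternating (negbTE y2A) => /andP[_ /andP[_]]; case: (_ \in A).
    (* The default [y1] is the right value for empty [p2]: the successor of [y2] then wraps around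
       to [y1]. *)
    have hE : last y1 (rev p2) = nth y1 p2 0 by case: (p2) => //= a l; rewrite rev_cons last_rcons.
    rewrite rcons_cat cat_path /= -hE in en2 *.
    rewrite rcons_path in P2r; case/andP: P2r => -> _ /=.
    rewrite !rcons_path last_rcons /=.
    have -> : alternating A x y1 by rewrite /alternating e1 xA y1A.
    have -> : alternating A y2 x by rewrite alternating_sym /alternating e2 xA y2A.
    have -> /= : alternating A (last y1 (rev p2)) y'.
      by rewrite alternating_sym /alternating en2 hA (negbTE y'A).
    rewrite andbT; have P1' : path (alternating A) y1 (rcons p1 y2) by rewrite rcons_path P1 ly2.
    rewrite -rcons_path.
    (* If [p1] were empty, [y1] and [y2] would be consecutive on [c] although neither lies in
       [A]. *)
    case: p1 P1' en1 {rc P1 P2 xc y'c ly2 ucc mc y2p1 mz} => [|h p1] /=.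
      by rewrite /alternating (negbTE y1A) (negbTE y2A) andbF.
    case/andP=> /andP[_]; rewrite (negbTE y1A) => hA1 ph ee.
    by rewrite /alternating (negbTE y'A) ee hA1.
  rewrite (eq_all_r mz) /= !inE xA y'B orbT /=.
  by case/and3P: gc.
by [].
Qed.

(** Each step covers one more vertex of [A], so it can be iterated. The vertices of [c0] stay
    covered, so [step] may rely on them. *)
Lemma alt_cycle_cover (A B : {set T}) c0 :
  alt_cycle A B c0 ->
  (forall c x, alt_cycle A B c -> {subset c0 <= c} -> x \in A -> x \notin c ->
     exists y c', alt_cycle A B c' /\ c' =i x :: y :: c) ->
  exists2 c, alt_cycle A B c & {subset A <= c}.
Proof.
move=> g0 step.
have [n le_n] := ubnP #|A :\: [set z in c0]|.
suff H : forall c, alt_cycle A B c -> {subset c0 <= c} -> #|A :\: [set z in c]| < n ->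
  exists2 c, alt_cycle A B c & {subset A <= c} by exact: (H c0).
elim: n {le_n} => // n IHn c gc c0c le_n.
have [/subsetP Ac | /subsetPn[x xA xc]] := boolP (A \subset c); first by exists c.
have [y [c' [gc' mc']]] := step c x gc c0c xA xc.
apply: (IHn c') => //; first by move=> z /c0c zc; rewrite mc' !inE zc !orbT.
rewrite -ltnS; apply: leq_trans le_n; rewrite ltnS; apply: proper_card.
apply/properP; split.
  by apply/subsetP=> z; rewrite !inE mc' !inE !negb_or => /andP[/and3P[_ _ ->] ->].
by exists x; rewrite !inE ?xA ?xc // mc' inE eqxx.
Qed.

Lemma alt_cycle_card (A B : {set T}) c :
  [disjoint A & B] -> alt_cycle A B c ->
  #|B :&: [set z in c]| = #|A :&: [set z in c]|.
Proof.
move=> dAB /and3P[uc cyc cAB].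
have cnt (X : {set T}) : #|X :&: [set z in c]| = count (mem X) c.
  rewrite -size_filter -(card_uniqP (filter_uniq (mem X) uc)).
  by apply: eq_card => z; rewrite !inE mem_filter.
have := alt_cycle_size cyc; rewrite !cnt.
have -> : size c = count (mem A) c + count (mem B) c.
  rewrite -(count_predC (mem A)); congr addn; apply: eq_in_count => z zc /=.
  have /setUP[zA|zB] := allP cAB z zc; first by rewrite zA (disjointFr dAB zA).
  by rewrite zB (disjointFl dAB zB).
by lia.
Qed.

Lemma alt_cycle_pair (A B : {set T}) a u :
  a \in A -> u \in B -> u \notin A -> e a u -> alt_cycle A B [:: a; u].
Proof.
move=> aA uB uA eau; rewrite /alt_cycle /= /alternating !inE aA uB (negbTE uA) eau e_sym eau /=.
by rewrite ?orbT !andbT; apply: contraNneq uA => <-.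
Qed.

Lemma alt_cycle_next (A B : {set T}) c y :
  alt_cycle A B c -> y \in c -> y \notin A -> next c y \in A.
Proof.
case/and3P=> _ cyc _ yc yA; have := next_cycle cyc yc.
by rewrite /alternating (negbTE yA) => /andP[_]; case: (_ \in A).
Qed.

Lemma alt_cycle_prev (A B : {set T}) c y :
  alt_cycle A B c -> y \in c -> y \in A ->
  [/\ prev c y \in c, prev c y \in B & prev c y \notin A].
Proof.
case/and3P=> uc cyc /allP cAB yc yA; have := prev_cycle cyc yc.
have pc : prev c y \in c by rewrite mem_prev.
rewrite /alternating yA => /andP[_]; have := cAB _ pc; rewrite !inE.
by case: (_ \in A) => //= ->.
Qed.

(* Each y on the cycle adjacent to an uncovered x has a successor whose
   neighbours off the cycle avoid those of x and of the other such
   successors; the degree condition leaves no room for all of them. *)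
Lemma alt_cycle_degree (A B : {set T}) d u :
  [disjoint A & B] -> A != set0 -> u \in B -> {in A, forall a, e a u} ->
  {in A, forall a, #|[set y in B | ~~ e a y]| <= d} ->
  d + #|A| <= #|B| -> 2 * d + 2 <= #|B| ->
  exists2 c, alt_cycle A B c & {subset A <= c}.
Proof.
move=> dAB /set0Pn[a0 a0A] uB eu deg le1 le2.
have BA y : y \in B -> y \notin A by move=> yB; rewrite (disjointFl dAB).
apply: (@alt_cycle_cover A B [:: a0; u]).
  by apply: alt_cycle_pair; rewrite ?BA // eu.
move=> c x gc c0c xA xc; have uc : u \in c by apply: c0c; rewrite !inE eqxx orbT.
pose C := [set z in c]; pose I := [set y in B :&: C | e x y]; pose D := B :\: C.
have [/existsP[y /andP[yI /existsP[y' /and3P[y'D exy' ey']]]]|no1] :=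
    boolP [exists y in I, exists y' in D, e x y' && e y' (next c y)].
  move: yI y'D; rewrite !inE => /andP[/andP[yB yc] exy] /andP[y'c y'B].
  have [c' gc' mc'] := alt_cycle_insert gc xA xc yc (BA _ yB) y'B (BA _ y'B) y'c exy exy' ey'.
  by exists y', c'.
have [/existsP[y1 /andP[y1I /existsP[y2 /andP[y2I /existsP[y' /and4P[y'D y12 ey1 ey2]]]]]]|no2] :=
    boolP [exists y1 in I, exists y2 in I, exists y' in D,
            [&& y1 != y2, e y' (next c y1) & e y' (next c y2)]].
  move: y1I y2I y'D; rewrite !inE.
  move=> /andP[/andP[y1B y1c] exy1] /andP[/andP[y2B y2c] exy2] /andP[y'c y'B].
  have [c' gc' mc'] := alt_cycle_cross gc xA xc y1c (BA _ y1B) y2c (BA _ y2B) y12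
    y'B (BA _ y'B) y'c exy1 exy2 ey1 ey2.
  by exists y', c'.
exfalso.
have uI : u \in I by rewrite !inE uB uc eu.
have I0 : 0 < #|I| by apply/card_gt0P; exists u.
pose Dx := [set y' in D | e x y'].
pose Dn y := [set y' in D | e y' (next c y)].
(* The sets [Dx] and [Dn y], for [y] in [I], are pairwise disjoint in [D]: a vertex common to [Dx]
   and some [Dn y] contradicts [no1], one common to two of the [Dn y] contradicts [no2]. *)
have S1 : #|Dx| + \sum_(y in I) #|Dn y| <= #|D|.
  have -> : \sum_(y in I) #|Dn y| = \sum_(y' in D) #|[set y in I | e y' (next c y)]|.
    transitivity (\sum_(y in I) \sum_(y' in D) e y' (next c y)).
      apply: eq_bigr => y _; rewrite -sum1_card big_mkcond [RHS]big_mkcond /=.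
      by apply: eq_bigr => y' _; rewrite inE; case: (_ \in D); case: (e _ _).
    rewrite exchange_big; apply: eq_bigr => y' _.
    rewrite -sum1_card big_mkcond [RHS]big_mkcond /=.
    by apply: eq_bigr => y _; rewrite inE; case: (_ \in I); case: (e _ _).
  have -> : #|Dx| = \sum_(y' in D) e x y'.
    rewrite -sum1_card big_mkcond [RHS]big_mkcond /=.
    by apply: eq_bigr => y _; rewrite inE; case: (_ \in D); case: (e _ _).
  rewrite -big_split -sum1_card /=; apply: leq_sum => y' y'D.
  case exy': (e x y').
    rewrite [X in _ + X]eq_card0 // => y; rewrite [LHS]inE.
    apply: contraNF no1 => /andP[yI ey]; apply/existsP; exists y; rewrite yI /=.
    by apply/existsP; exists y'; rewrite y'D exy' ey.
  rewrite add0n leqNgt; apply: contra no2 => /card_gt1P[y1 [y2 []]].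
  rewrite inE => /andP[y1I ey1]; rewrite inE => /andP[y2I ey2] y12.
  apply/existsP; exists y1; rewrite y1I /=; apply/existsP; exists y2; rewrite y2I /=.
  by apply/existsP; exists y'; rewrite y'D y12 ey1 ey2.
have S2 : #|I| * (#|D| - d) <= \sum_(y in I) #|Dn y|.
  rewrite -sum_nat_const; apply: leq_sum => y; rewrite !inE => /andP[/andP[yB yc] _].
  have nA := alt_cycle_next gc yc (BA _ yB).
  rewrite leq_subLR; apply: leq_trans (leq_add (deg _ nA) (leqnn _)).
  apply: leq_trans (leq_card_setU _ _); apply: subset_leq_card; apply/subsetP=> z.
  by rewrite !inE [e (next _ _) _]e_sym => /andP[-> ->]; case: (e _ _).
have S3 : #|D| + #|B :&: C| <= d + #|Dx| + #|I|.
  have -> : #|D| + #|B :&: C| = #|B| by rewrite addnC cardsID.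
  apply: leq_trans (leq_add (leq_add (deg _ xA) (leqnn _)) (leqnn _)).
  apply: leq_trans (leq_add (leq_card_setU _ _) (leqnn _)).
  apply: leq_trans (leq_card_setU _ _); apply: subset_leq_card; apply/subsetP=> z.
  by rewrite !inE => ->; case: (e _ _); case: (z \in c).
have S4 : #|B :&: C| < #|A|.
  rewrite (alt_cycle_card dAB gc); apply: proper_card; apply/properP; split; first exact: subsetIl.
  by exists x; rewrite // !inE xA.
have S5 : #|B :&: C| + #|D| = #|B| by rewrite cardsID.
move: S1 S2 S3 S4 S5 le1 le2 I0; move: (\sum_(_ in _) _) => s.
move: #|D| #|B :&: C| #|B| #|Dx| #|I| #|A| => D' r b dx i a.
(* The bounds give [r + i * (D' - d - 1) <= d] with [d < D']. As [i >= 1] and [r + D' = b], this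
   yields [b <= 2 * d + 1], a contradiction. *)
clear; nia.
Qed.

(** If an uncovered [x] has a neighbour in [B] off the cycle, both are inserted next to [x0], which
    is joined to all of [B]. Otherwise [x] and a single [y0] in [B] are all that is left, and they
    enter by a crossing at [x0] and another neighbour of [y0]. *)
Lemma alt_cycle_few_missing (A B : {set T}) x0 u :
  [disjoint A & B] -> #|A| = #|B| ->
  x0 \in A -> {in B, forall y, e x0 y} ->
  u \in B -> {in A, forall a, e a u} ->
  {in A, forall a, #|[set y in B | ~~ e a y]| <= 1} ->
  {in B, forall y, exists2 a, a \in A :\ x0 & e a y} ->
  exists2 c, alt_cycle A B c & {subset A <= c}.
Proof.
move=> dAB cAB x0A ex0 uB eu deg cov.
have BA y : y \in B -> y \notin A by move=> yB; rewrite (disjointFl dAB).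
apply: (@alt_cycle_cover A B [:: x0; u]).
  by apply: alt_cycle_pair; rewrite ?BA // eu.
move=> c x gc c0c xA xc; have uc : u \in c by apply: c0c; rewrite !inE eqxx orbT.
have x0c : x0 \in c by apply: c0c; rewrite !inE eqxx.
pose C := [set z in c]; pose D := B :\: C.
have uqc : uniq c by case/and3P: gc.
have red1 y1 y2 : y1 \in B -> y2 \in B -> ~~ e x y1 -> ~~ e x y2 -> y1 = y2.
  move=> y1B y2B e1 e2; apply: (card_le1_eqP (deg x xA)); by rewrite inE ?y1B ?y2B.
have cD : #|A :\: C| = #|D|.
  by have := alt_cycle_card dAB gc; have := cardsID C A; have := cardsID C B; rewrite -/C /D; lia.
have [y0 y0D] : exists y, y \in D.
  by apply/card_gt0P; rewrite -cD; apply/card_gt0P; exists x; rewrite !inE xc.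
have [p0c p0B p0A] := alt_cycle_prev gc x0c x0A.
have [/existsP[y' /andP[y'D exy']]|nex] := boolP [exists y' in D, e x y'].
  move: y'D; rewrite !inE => /andP[y'c y'B].
  have ey'0 : e y' x0 by rewrite e_sym ex0.
  case ex2: (e x (prev c x0)).
    have [|c' ? ?] := alt_cycle_insert gc xA xc p0c p0A y'B (BA _ y'B) y'c ex2 exy'.
      by rewrite next_prev.
    by exists y', c'.
  have [n0c n0B n0A] : [/\ next c x0 \in c, next c x0 \in B & next c x0 \notin A].
    have := @alt_cycle_prev A B (rev c) x0; rewrite alt_cycle_rev // !mem_rev prev_rev //.
    exact.
  case ex1: (e x (next c x0)).
    have [|c' ? ?] := alt_cycle_insert_prev gc xA xc n0c n0A y'B (BA _ y'B) y'c ex1 exy'.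
      by rewrite prev_next.
    by exists y', c'.
  (* Here [x] misses both neighbours of [x0] on the cycle, so they coincide and the cycle consists
     of [x0] and [u] only; but [x] is adjacent to [u]. *)
  have E := red1 _ _ n0B p0B (negbT ex1) (negbT ex2).
  have : u = next c x0.
    have [i s rc] := rot_to x0c.
    have us : uniq (x0 :: s) by rewrite -rc rot_uniq.
    move: uc E; rewrite -(mem_rot i) -(next_rot i uqc) -(prev_rot i uqc) rc inE.
    case/orP=> [/eqP u0|]; first by have := BA _ uB; rewrite u0 x0A.
    rewrite next_nth prev_nth mem_head /= eqxx.
    move: us; case: s {rc} => // h s; rewrite [nth _ _ _]/= => /andP[x0s us].
    have -> : index x0 (h :: s) = size (h :: s) by apply: memNindex.
    rewrite /= -last_nth; case/lastP: s us x0s => [|s z] us x0s; first by rewrite inE => /eqP.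
    rewrite /= last_rcons => _ E; move: us; rewrite /= mem_rcons E.
    by rewrite inE eqxx.
  by move=> E'; move: ex1; rewrite -E' eu.
have redD y : y \in D -> ~~ e x y.
  by move=> yD; apply: contra nex => exy; apply/existsP; exists y; rewrite yD.
have y0B : y0 \in B by move: y0D; rewrite inE => /andP[].
have D1 y : y \in D -> y = y0.
  by move=> yD; apply: red1; rewrite ?redD //; move: yD; rewrite inE => /andP[].
have [a] := cov y0 y0B; rewrite !inE => /andP[ax0 aA] eay0.
have ac : a \in c.
  apply: contraT => ac; have : #|A :\: C| <= 1.
    by rewrite cD; apply/card_le1_eqP=> y z /D1-> /D1->.
  move/card_le1_eqP/(_ a x); rewrite !inE ac aA xc xA => /(_ isT isT) E.
  by have := redD _ y0D; rewrite E eay0.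
have [p1c p1B p1A] := alt_cycle_prev gc ac aA.
have ec y : y \in c -> y \in B -> e x y.
  move=> yc yB; apply: contraT => nexy; have E := red1 y y0 yB y0B nexy (redD _ y0D).
  by move: y0D; rewrite !inE -E yc.
have y0c : y0 \notin c by move: y0D; rewrite !inE => /andP[].
have n01 : prev c x0 != prev c a.
  by apply: contraNneq ax0 => E; rewrite -(next_prev uqc a) -E next_prev.
have [||c' ? ?] := alt_cycle_cross gc xA xc p0c p0A p1c p1A n01 y0B (BA _ y0B) y0c
  (ec _ p0c p0B) (ec _ p1c p1B).
- by rewrite next_prev // e_sym ex0.
- by rewrite next_prev // e_sym.
by exists y0, c'.
Qed.

End AlternatingCycles.

(** * Jahangir graphs in the complement *)

(** Rotated to start in [A], the cycle has the vertices of [A] exactly at its even positions, which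
    are the ones the hub [h] must be joined to. *)
Lemma jahangir_of_alt_cycle (F : sgraph) (A B : {set F}) m c h :
  1 < m -> #|A| = m -> alt_cycle (@adj F) A B c -> {subset A <= c} -> h \notin c ->
  {in A, forall a, adj h a} -> contains F (jahangir m).
Proof.
move=> m1 cA gc Ac hc ha.
have [a0 a0A] : exists a, a \in A by apply/card_gt0P; lia.
have [i s rc] := rot_to (Ac _ a0A).
have hs : h \notin a0 :: s by rewrite -rc mem_rot.
have {}Ac : {subset A <= a0 :: s} by move=> z /Ac; rewrite -rc mem_rot.
move: gc; rewrite -(alt_cycle_rot _ _ _ i) rc => /and3P[us cyc _] {i rc hc c}.
have sz : size (a0 :: s) = 2 * m.
  rewrite (alt_cycle_size cyc) -cA; congr (2 * _).
  rewrite -size_filter -(card_uniqP (filter_uniq _ us)).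
  by apply: eq_card => z; rewrite mem_filter /=; apply: andb_idr => /Ac.
have := cyc; rewrite /= rcons_path => /andP[ps /andP[ls _]].
have step (i : 'I_(2 * m)) : adj (nth a0 (a0 :: s) i) (nth a0 (a0 :: s) (ordS i)).
  have [iS|iS] := ltnP i.+1 (2 * m).
    by rewrite /= modn_small //; move/(pathP a0)/(_ i): ps; case/(_ _)/andP => //; move: sz => /=; lia.
  have E : nat_of_ord i = size s by have := ltn_ord i; move: sz => /=; lia.
  have -> : nat_of_ord (ordS i) = 0 by rewrite /= E -[(size s).+1]/(size (a0 :: s)) sz modnn.
  by rewrite E -last_nth.
have inA (i : 'I_(2 * m)) : ~~ odd i -> nth a0 (a0 :: s) i \in A.
  by move=> oi; rewrite (alternating_path_nth ps) ?a0A ?oi // -[(size s).+1]/(size (a0 :: s)) sz.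
pose f (v : jahangir m) : F := if v is Some i then nth a0 (a0 :: s) (i : 'I_(2 * m)) else h.
have in_s (i : 'I_(2 * m)) : nth a0 (a0 :: s) i \in a0 :: s by rewrite mem_nth // sz.
have lt_s (i : 'I_(2 * m)) : i < size (a0 :: s) by rewrite sz.
exists f.
  move=> [i|] [j|] //= E.
  - congr Some; apply: ord_inj; apply/eqP.
    by rewrite -(nth_uniq a0 (lt_s i) (lt_s j) us); apply/eqP.
  - by move: hs; rewrite -E in_s.
  - by move: hs; rewrite E in_s.
move=> [i|] [j|]; rewrite /= /simple_rel /= ?andbF ?orbF //.
- case/andP=> _; rewrite [simple_rel _ j i]simple_rel_sym orbb.
  by case/andP=> _ /orP[] /eqP <-; [exact: step | rewrite adj_sym; exact: step].
- by move/inA/ha; rewrite adj_sym.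
by move/inA/ha.
Qed.

(* Depth-first search: in the proof, U is the current path and S the set of
   finished vertices; the vertices not yet met have no neighbour in S. *)
Lemma bipartite_hole (F : sgraph) p a b :
  (forall s : seq F, uniq s -> sorted (@adj F) s -> size s <= p) ->
  0 < a -> 0 < b -> a + b + p <= #|F|.+1 ->
  exists S T : {set F},
    [/\ [disjoint S & T], #|S| = a, b <= #|T| & {in S & T, forall x y, ~~ adj x y}].
Proof.
move=> pmax a0 b0 leN.
pose state (S : {set F}) (U : seq F) :=
  [/\ uniq U, sorted (@adj F) U, [disjoint S & U]
    & {in S & ~: (S :|: [set z in U]), forall x y, ~~ adj x y}].
have cardT (S : {set F}) (U : seq F) : uniq U -> [disjoint S & U] ->
    #|~: (S :|: [set z in U])| + #|S| + size U = #|F|.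
  move=> uU dU; rewrite -(card_uniqP uU) -addnA.
  have -> : #|S| + #|U| = #|S :|: [set z in U]|.
    rewrite cardsU [S :&: _](_ : _ = set0) ?cards0 ?subn0 ?cardsE //.
    by apply/setP=> z; rewrite !inE; case zS: (z \in S); rewrite // (disjointFr dU).
  by rewrite addnC cardsC.
(* The search continues until the top [x] of the path has no unmet neighbour. The number [k] bounds
   the unmet vertices, and each push uses one of them up. *)
have grow k (S : {set F}) (U : seq F) : #|S| < a -> state S U -> #|~: (S :|: [set z in U])| <= k ->
    exists (x : F) (U' : seq F), state S (x :: U') /\
      {in ~: (S :|: [set z in x :: U']), forall y, ~~ adj x y}.
  elim: k U => [|k IHk] U ltS [uU sU dU noe] leT.
    have := cardT _ _ uU dU; have := pmax _ uU sU; move: leT leN ltS b0; clear.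
    move: #|~: _| #|S| (size U) #|F|; lia.
  have push x : x \notin S -> x \notin U -> sorted (@adj F) (x :: U) ->
      exists (x : F) (U' : seq F), state S (x :: U') /\
      {in ~: (S :|: [set z in x :: U']), forall y, ~~ adj x y}.
    move=> xS xU xsU; apply: (IHk (x :: U)) => //.
      split=> //=; first by rewrite xU.
        by rewrite disjoint_sym disjoint_cons disjoint_sym xS.
      move=> y z yS; rewrite !inE !negb_or => /and3P[zS _ zU]; apply: noe => //.
      by rewrite !inE negb_or zS.
    rewrite -ltnS; apply: leq_trans leT; apply: proper_card.
    apply/properP; split; last by exists x; rewrite !inE ?eqxx ?orbT // (negbTE xS) (negbTE xU).
    by apply/subsetP=> z; rewrite !inE !negb_or => /and3P[-> _ ->].
  case: U uU sU dU noe leT push => [|x U] uU sU dU noe leT push.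
    have /card_gt0P[x] : 0 < #|~: (S :|: [set z in [::]])|.
      have := cardT _ _ uU dU; have := pmax _ uU sU; move: leN ltS b0; clear.
      by move: #|~: _| #|S| (size _) #|F|; lia.
    by rewrite !inE orbF => xS; apply: (push x).
  have [/existsP[y /andP[yT xy]]|nex] :=
    boolP [exists y in ~: (S :|: [set z in x :: U]), adj x y].
    move: yT; rewrite !inE !negb_or => /and3P[yS yx yU]; apply: (push y) => //.
      by rewrite inE negb_or yx.
    by rewrite /= adj_sym xy.
  exists x, U; split=> // y yT; apply: contra nex => xy; apply/existsP; exists y.
  by rewrite yT.
(* The vertex finished last has just left a path with at most [p] vertices, so at most [p - 1]
   remain on the path; this accounts for the [.+1]. *)
have H k : 0 < k -> k <= a -> exists (S : {set F}) (U : seq F), [/\ state S U, #|S| = k &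
    #|F|.+1 <= #|~: (S :|: [set z in U])| + k + p].
  elim: k => // k IHk _ lek.
  have [S [U [st cS]]] : exists S U, state S U /\ #|S| = k.
    case: k IHk lek => [|k] IHk lek; last first.
      by have [S [U [? ? _]]] := IHk isT (ltnW lek); exists S, U.
    exists set0, [::]; split; last by rewrite cards0.
    split=> //; first by rewrite disjoint_sym disjoint0 //; apply/pred0P=> z; rewrite !inE.
    by move=> x y; rewrite inE.
  have [|x [U' [[uU sU dU noe] nox]]] := grow _ S U _ st (leqnn _); first by rewrite cS.
  move: uU dU; rewrite disjoint_sym disjoint_cons => uU /andP[xS dU]; case/andP: (uU) => xU uU'.
  have ET : x |: S :|: [set z in U'] = S :|: [set z in x :: U'].
    by apply/setP=> z; rewrite !inE; case: (z == x); rewrite ?orbT.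
  exists (x |: S), U'; split.
  - split=> //; first exact: path_sorted sU.
      rewrite disjoint_sym; apply/pred0P=> z /=; rewrite !inE.
      case zU: (z \in U') => //=; rewrite (disjointFr dU zU) orbF.
      by apply: contraNF xU => /eqP <-.
    move=> y z; rewrite ET !in_setU1 => /orP[/eqP -> | yS] zT; first exact: nox.
    exact: noe.
  - by rewrite cardsU1 xS cS.
  rewrite ET; have := cardT S (x :: U') uU; have := pmax _ uU sU.
  rewrite disjoint_sym disjoint_cons xS dU cS => + /(_ isT); clear.
  by move: #|~: _| (size _) #|F|; lia.
have [S [U [[uU sU dU noe] cS bT]]] := H a a0 (leqnn _).
exists S, (~: (S :|: [set z in U])); split=> //; last first.
  by move: bT leN; clear; move: #|~: _| #|F|; lia.
by rewrite -subsets_disjoint subsetUl.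
Qed.

(** The degree criterion is applied in the complement, where the edges of [F] are the missing ones;
    [h] becomes the hub. *)
Lemma jahangir_of_degree (F : sgraph) (A B : {set F}) m d h u :
  1 < m -> #|A| = m -> [disjoint A & B] -> h \notin A -> h \notin B -> u \in B ->
  {in A, forall a, ~~ adj h a} -> {in A, forall a, ~~ adj a u} ->
  {in A, forall a, #|[set y in B | adj a y]| <= d} ->
  d + m <= #|B| -> 2 * d + 2 <= #|B| ->
  contains (complement F) (jahangir m).
Proof.
move=> m1 cA dAB hA hB uB ha au deg le1 le2.
have ne a y : a \in A -> y \in B -> a != y.
  by move=> aA yB; apply: contraTneq aA => ->; rewrite (disjointFl dAB).
have [||a aA|a aA|||c gc Ac] := @alt_cycle_degree (complement F) _ (@compl_adj_sym F) A B d u dAB;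
  rewrite ?cA //.
- by rewrite -card_gt0 cA; lia.
- by rewrite /compl_adj ne //= au.
- apply: leq_trans (deg a aA); apply: subset_leq_card; apply/subsetP=> y.
  by rewrite !inE /compl_adj => /andP[yB]; rewrite ne // yB negbK.
apply: (@jahangir_of_alt_cycle (complement F) A B m c h) => //.
  case/and3P: gc => _ _ /allP cAB; apply: contraNN hB => /cAB; rewrite !inE.
  by rewrite (negbTE hA).
by move=> a aA; rewrite /= /compl_adj ha // andbT; apply: contraNneq hA => ->.
Qed.

(** A vertex [y] of [B] joined in [F] to all of [A :\ x0] cannot lie on the cycle and is exchanged
    for [y']. Then no vertex of [A :\ x0] has an edge of [F] to the new set, its only one having
    gone with [y]. *)
Lemma jahangir_of_few_missing (F : sgraph) (A B : {set F}) m x0 h u :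
  2 < m -> #|A| = m -> #|B| = m -> [disjoint A & B] -> h \notin A -> h \notin B ->
  x0 \in A -> {in B, forall y, ~~ adj x0 y} -> u \in B ->
  {in A, forall a, ~~ adj h a} -> {in A, forall a, ~~ adj a u} ->
  {in A, forall a, #|[set y in B | adj a y]| <= 1} ->
  {in B, forall y, (exists2 a, a \in A :\ x0 & ~~ adj a y) \/
     exists y', [/\ y' \notin A, y' \notin B, y' != h & {in A :\ x0, forall a, ~~ adj a y'}]} ->
  contains (complement F) (jahangir m).
Proof.
move=> m2.
have direct (A' B' : {set F}) x1 u' : #|A'| = m -> #|B'| = m -> [disjoint A' & B'] -> h \notin A' ->
    h \notin B' -> x1 \in A' -> {in B', forall y, ~~ adj x1 y} -> u' \in B' ->
    {in A', forall a, ~~ adj h a} -> {in A', forall a, ~~ adj a u'} ->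
    {in A', forall a, #|[set y in B' | adj a y]| <= 1} ->
    {in B', forall y, exists2 a, a \in A' :\ x1 & ~~ adj a y} ->
    contains (complement F) (jahangir m).
  move=> cA cB dAB hA hB x0A x0B uB ha au deg cov.
  have ne a y : a \in A' -> y \in B' -> a != y.
    by move=> aA yB; apply: contraTneq aA => ->; rewrite (disjointFl dAB).
  have [||y yB||a aA|a aA|y yB|c gc Ac] :=
    @alt_cycle_few_missing (complement F) _ (@compl_adj_sym F) A' B' x1 u' dAB; rewrite ?cA ?cB //.
  - by rewrite /compl_adj ne //= x0B.
  - by rewrite /compl_adj ne //= au.
  - apply: leq_trans (deg a aA); apply: subset_leq_card; apply/subsetP=> y.
    by rewrite !inE /compl_adj => /andP[yB]; rewrite ne // yB negbK.
  - have [a aA ay] := cov y yB; exists a => //; rewrite /compl_adj ay ne //.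
    by move: aA; rewrite inE => /andP[].
  apply: (@jahangir_of_alt_cycle (complement F) A' B' m c h) => //; first by lia.
    case/and3P: gc => _ _ /allP cAB; apply: contraNN hB => /cAB; rewrite !inE.
    by rewrite (negbTE hA).
  by move=> a aA; rewrite /= /compl_adj ha // andbT; apply: contraNneq hA => ->.
move=> cA cB dAB hA hB x0A x0B uB ha au deg cov.
have [/forallP all_cov|/forallPn[y]] :=
    boolP [forall y, (y \in B) ==> [exists a in A :\ x0, ~~ adj a y]].
  apply: (direct A B x0 u) => // y yB.
  have := all_cov y; rewrite yB => /existsP[a /andP[aA ay]]; exists a => //.
rewrite negb_imply => /andP[yB /existsPn nocov].
have ay a : a \in A :\ x0 -> adj a y.
  by move=> aA; have := nocov a; rewrite aA negbK.
have [[a aA]|[y' [y'A y'B y'h ay']]] := cov y yB; first by rewrite ay.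
have cA0 : #|A :\ x0| = m.-1 by have := cardsD1 x0 A; rewrite x0A cA; lia.
have /card_gt1P[a1 [a2 [a1A a2A a12]]] : 1 < #|A :\ x0| by rewrite cA0; lia.
have uy : u != y.
  apply: contraTneq (ay _ a1A) => <-; apply: au; by move: a1A; rewrite inE => /andP[].
have inA a : a \in A :\ x0 -> a \in A by rewrite inE => /andP[].
have blue a z : a \in A :\ x0 -> z \in y' |: B :\ y -> ~~ adj a z.
  move=> aA; rewrite !inE => /orP[/eqP-> | /andP[zy zB]]; first exact: ay'.
  apply: contra zy => az; apply/eqP/(card_le1_eqP (deg a (inA _ aA)));
    by rewrite inE ?zB ?yB ?ay.
(* The role of [x0] passes to [a1], since [x0] may be adjacent in [F] to [y']. *)
apply: (direct A (y' |: B :\ y) a1 u) => //.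
- by rewrite cardsU1 !inE (negbTE y'B) andbF /= -[RHS]cB (cardsD1 y B) yB.
- apply/pred0P=> z /=; case zA: (z \in A) => //=; rewrite !inE (disjointFr dAB zA) andbF orbF.
  by apply: contraNF y'A => /eqP <-.
- by rewrite !inE negb_or (negbTE hB) andbF eq_sym y'h.
- exact: inA.
- by move=> z; apply: blue.
- by rewrite !inE uy uB orbT.
- move=> a aA; have [ax0|ax0] := eqVneq a x0; last first.
    rewrite (_ : [set _ in _ | _] = set0) ?cards0 //; apply/setP=> z; rewrite [LHS]inE in_set0.
    by apply: contraTF isT => /andP[zB]; rewrite (negbTE (blue a z _ zB)) // !inE ax0 aA.
  rewrite -(cards1 y'); apply: subset_leq_card; apply/subsetP=> z.
  rewrite !inE ax0 => /andP[/orP[-> // | /andP[_ zB]]]; by rewrite (negbTE (x0B _ zB)).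
move=> z zB; exists a2; last exact: blue.
by rewrite !inE eq_sym a12 inA.
Qed.

(** * Vertices outside a longest path *)

Lemma sorted_rev_cat (T : Type) (e : rel T) x y s t :
  symmetric e -> sorted e (x :: s) -> sorted e (y :: t) -> e x y ->
  sorted e (rev (x :: s) ++ y :: t).
Proof.
move=> e_sym; rewrite -catrevE /=.
elim: s x y t => [|z s IHs] x y t /=; first by move=> _ -> ->.
by case/andP=> xz zs yt xy; apply: IHs; rewrite //= ?xy // e_sym.
Qed.

Lemma subset_of_card (T : finType) (X : {set T}) k :
  k <= #|X| -> exists2 Y : {set T}, Y \subset X & #|Y| = k.
Proof.
case/card_geqP=> s [us sz sX]; exists [set y in s].
  by apply/subsetP=> y; rewrite inE => /sX.
by rewrite cardsE (card_uniqP us).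
Qed.

(* The hypotheses force N = {1, 3, .., 2a-1} U {2a+2, 2a+4, .., 2m-2} on
   0 < i < 2m - 1, for some a. *)
Lemma dense_nonconsecutive (N : pred nat) m :
  (forall k, k < m.-1 -> N (2 * k).+1 || N (2 * k).+2) ->
  (forall i, i.+1 < 2 * m -> N i -> ~~ N i.+1) ->
  forall i j, i < j -> j.+2 < 2 * m -> ~~ N i.+1 -> ~~ N j.+1 ->
  [\/ j = i.+1, N i /\ N j | N i.+2 /\ N j.+2].
Proof.
move=> pair nc i j ij jm Ni Nj.
have chain k l : k <= l -> l < m -> N (2 * k) -> N (2 * l).
  elim: l => [|l IHl]; first by rewrite leqn0 => /eqP->.
  rewrite leq_eqVlt => /predU1P[-> //|]; rewrite ltnS => kl lm Nk.
  have Nl := IHl kl (ltnW lm) Nk.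
  have /orP[|] := pair l ltac:(move: lm; clear; lia).
    by rewrite (negbTE (nc _ _ Nl)) //; move: lm; clear; lia.
  by rewrite mulnS.
have odd_case k : odd k -> k.+2 < 2 * m -> ~~ N k.+1 -> N k.
  move=> ok km Nk; have := pair k./2; rewrite (_ : k./2 < m.-1); last by move: km; clear; lia.
  by rewrite (_ : (2 * k./2).+1 = k) ?(negbTE Nk) ?orbF; [apply | move: ok; clear; lia].
have even_case k : ~~ odd k -> k.+2 < 2 * m -> ~~ N k.+1 -> N k.+2.
  move=> ok km Nk; have := pair k./2; rewrite (_ : k./2 < m.-1); last by move: km; clear; lia.
  by rewrite (_ : (2 * k./2) = k) ?(negbTE Nk); [apply | move: ok; clear; lia].
have im : i.+2 < 2 * m by apply: leq_ltn_trans jm; rewrite !ltnS ltnW.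
have [oi|oi] := boolP (odd i); have [oj|oj] := boolP (odd j).
- by apply: Or32; split; apply: odd_case.
- have Ni0 := odd_case i oi im Ni.
  have [->|ne] := eqVneq j i.+1; first exact: Or31.
  have /orP[Nk|Nk] := pair i.+1./2 ltac:(move: ij ne jm oi oj; clear; lia).
    rewrite (_ : (2 * i.+1./2).+1 = i.+2) in Nk; last by move: oi; clear; lia.
    by apply: Or33; split=> //; apply: even_case.
  apply: Or32; split=> //.
  have := chain i.+1./2.+1 j./2; rewrite (_ : 2 * j./2 = j); last by move: oj; clear; lia.
  apply; [by move: ij ne oi oj; clear; lia | by move: jm; clear; lia |].
  by rewrite mulnS.
- have Ni2 := even_case i oi im Ni.
  have : N (2 * j.+1./2).
    have := chain i./2.+1 j.+1./2; apply; [by move: ij; clear; lia | by move: jm; clear; lia |].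
    by rewrite mulnS (_ : 2 * i./2 = i) //; move: oi; clear; lia.
  by rewrite (_ : 2 * j.+1./2 = j.+1) ?(negbTE Nj) //; move: oj; clear; lia.
by apply: Or33; split; apply: even_case.
Qed.

Section LongestPath.

Variables (F : sgraph) (P : seq F) (v0 : F).
Hypotheses (uP : uniq P) (sP : sorted (@adj F) P).
Hypothesis maxP : forall s : seq F, uniq s -> sorted (@adj F) s -> size s <= size P.

Local Notation v i := (nth v0 P i).
Local Notation p := (size P).

Lemma sorted_rev_adj (s : seq F) : sorted (@adj F) (rev s) = sorted (@adj F) s.
Proof. by rewrite rev_sorted; case: s => //= x s; apply: eq_path => y z; rewrite adj_sym. Qed.

(** Otherwise the part of [P] before [v i], or the part after it, could be exchanged for the longer
    path outside [P]. *)
Lemma nbr_of_outer_path x w i :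
  uniq (x :: w) -> sorted (@adj F) (x :: w) -> {in x :: w, forall y, y \notin P} ->
  i < p -> adj x (v i) -> (size w).+1 <= i /\ i + (size w).+1 < p.
Proof.
move=> uw sw wP ip xv.
have dw s : subseq s P -> ~~ has (mem (rev (x :: w))) s.
  move=> sP'; apply/hasPn=> y /(mem_subseq sP') yP.
  by rewrite /= mem_rev; apply: contraTN yP => /wP.
split.
- have := maxP (s := rev (x :: w) ++ drop i P).
  rewrite cat_uniq rev_uniq uw drop_uniq // dw ?drop_subseq // => /(_ isT).
  rewrite (drop_nth v0 ip) sorted_rev_cat //; last first.
  + by rewrite -drop_nth // drop_sorted.
  + exact: adj_sym.
  by move=> /(_ isT); rewrite -drop_nth // size_cat size_rev size_drop /=; lia.
have := maxP (s := rev (x :: w) ++ rev (take i.+1 P)).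
rewrite cat_uniq !rev_uniq uw take_uniq // has_rev dw ?take_subseq // => /(_ isT).
rewrite (take_nth v0 ip) rev_rcons sorted_rev_cat //; last first.
- by rewrite -rev_rcons -take_nth // sorted_rev_adj take_sorted.
- exact: adj_sym.
by move=> /(_ isT); rewrite -rev_rcons -take_nth // size_cat !size_rev size_take /=; case: ifP; lia.
Qed.

Lemma nbr_interior x i : x \notin P -> i < p -> adj x (v i) -> 0 < i /\ i.+1 < p.
Proof.
move=> xP ip xv; have [] := @nbr_of_outer_path x [::] i => //=.
  by move=> y; rewrite inE => /eqP->.
by rewrite addn1.
Qed.

Lemma nbr_not_consecutive x i :
  x \notin P -> i.+1 < p -> adj x (v i) -> ~~ adj x (v i.+1).
Proof.
move=> xP ip xi; apply/negP => xi1; have ip' := ltnW ip.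
have := maxP (s := take i.+1 P ++ x :: drop i.+1 P).
have -> : uniq (take i.+1 P ++ x :: drop i.+1 P).
  have /perm_uniq -> : perm_eq (take i.+1 P ++ x :: drop i.+1 P) (x :: P).
    by rewrite -[x :: drop _ _]cat1s perm_catCA /= cat_take_drop.
  by rewrite /= xP.
have -> : sorted (@adj F) (take i.+1 P ++ x :: drop i.+1 P).
  rewrite -[take _ _]revK (take_nth v0 ip') rev_rcons; apply: sorted_rev_cat.
  - exact: adj_sym.
  - by rewrite -rev_rcons -take_nth // sorted_rev_adj take_sorted.
  - by rewrite (drop_nth v0 ip) /= xi1 -[path _ _ _]/(sorted _ (_ :: _)) -drop_nth // drop_sorted.
  - by rewrite adj_sym.
move=> /(_ isT isT); rewrite size_cat /= size_drop size_take; case: ifP; lia.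
Qed.

(** Otherwise [P] up to [v i], then [x], then [P] backwards from [v j] to [v i.+1], then [x'], then
    [P] from [v j.+1] on would form a longer path. *)
Lemma nbr_not_crossing x x' i j :
  x \notin P -> x' \notin P -> x != x' -> i < j -> j.+1 < p ->
  adj x (v i) -> adj x (v j) -> adj x' (v i.+1) -> ~~ adj x' (v j.+1).
Proof.
move=> xP x'P xx' ij jp xi xj x'i; apply/negP=> x'j.
have jp' := ltnW jp; have ip := ltn_trans ij jp'; have ip1 : i.+1 < p by lia.
pose mid := drop i.+1 (take j.+1 P).
have EP : P = take i.+1 P ++ mid ++ drop j.+1 P.
  rewrite -{1}(cat_take_drop j.+1 P) catA; congr (_ ++ _).
  by rewrite -{1}(cat_take_drop i.+1 (take j.+1 P)) take_takel // ltnW.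
have mid1 : mid = v i.+1 :: drop i.+2 (take j.+1 P).
  by rewrite /mid (drop_nth v0) ?size_takel ?nth_take // ltnW.
have mid2 : mid = rcons (drop i.+1 (take j P)) (v j).
  by rewrite /mid (take_nth v0 jp') drop_rcons // size_takel // ltnW.
have smid : sorted (@adj F) mid by rewrite drop_sorted // take_sorted.
pose t := rev mid ++ x' :: drop j.+1 P.
have := maxP (s := take i.+1 P ++ x :: t).
have -> : uniq (take i.+1 P ++ x :: t).
  have /perm_uniq -> : perm_eq (take i.+1 P ++ x :: t) (x :: x' :: P).
    rewrite {2}EP /t; apply/permP=> a; rewrite /= !(count_cat, count_rev) /= count_cat count_rev /=.
    move: (nat_of_bool (a x)) (nat_of_bool (a x')) (count a mid); clear.
    by move: (count a _) (count a _); lia.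
  by rewrite /= inE negb_or xx' xP x'P.
have -> : sorted (@adj F) (take i.+1 P ++ x :: t).
  rewrite -[take _ _]revK (take_nth v0 ip) rev_rcons; apply: sorted_rev_cat.
  - exact: adj_sym.
  - by rewrite -rev_rcons -take_nth // sorted_rev_adj take_sorted.
  - have : sorted (@adj F) t.
      rewrite /t mid1; apply: sorted_rev_cat.
      + exact: adj_sym.
      + by rewrite -mid1.
      + by rewrite (drop_nth v0 jp) /= x'j -[path _ _ _]/(sorted _ (_ :: _)) -drop_nth // drop_sorted.
      + by rewrite adj_sym.
    by rewrite /t mid2 rev_rcons /= xj.
  - by rewrite adj_sym.
move=> /(_ isT isT); rewrite {2}EP /t !size_cat /= !size_cat size_rev /=; lia.
Qed.

(** * Neighbours on the path and their successors *)

Definition path_nbrs x := [set y in P | adj x y].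

Lemma path_nbrs_nth x y :
  y \in path_nbrs x -> [/\ index y P < p, v (index y P) = y & adj x (v (index y P))].
Proof. by rewrite inE => /andP[yP xy]; rewrite index_mem nth_index. Qed.

(** The positions from [l] on are grouped into consecutive pairs, and no pair contains two
    neighbours of [x]. *)
Lemma half_index_inj x l : x \notin P ->
  {in path_nbrs x, forall y, l <= index y P} ->
  {in path_nbrs x &, injective (fun y => (index y P - l)./2)}.
Proof.
move=> xP geP y z yN zN E.
wlog le : y z yN zN E / index y P <= index z P.
  by move=> H; case/orP: (leq_total (index y P) (index z P)) => /H->.
have [yi yE xy] := path_nbrs_nth yN; have [zi zE xz] := path_nbrs_nth zN.
have [Ei|Ei] : index z P = index y P \/ index z P = (index y P).+1.
- have := geP _ yN; have := geP _ zN; move: E le; clear.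
  by move: (index y P) (index z P) => i j; lia.
- by rewrite -yE -zE Ei.
have := nbr_not_consecutive xP _ xy; rewrite -Ei => /(_ zi).
by rewrite xz.
Qed.

Lemma card_path_nbrs x l : x \notin P ->
  {in path_nbrs x, forall y, l <= index y P /\ index y P + l < p} ->
  #|path_nbrs x| <= uphalf (p - 2 * l).
Proof.
move=> xP rg; rewrite cardE -(size_map (fun y => (index y P - l)./2)).
rewrite -[X in _ <= X](size_iota 0); apply: uniq_leq_size.
  rewrite map_inj_in_uniq ?enum_uniq // => y z; rewrite !mem_enum.
  by apply: half_index_inj => // w /rg[].
move=> k /mapP[y]; rewrite mem_enum => /rg[ly yl] ->.
by rewrite mem_iota /= add0n; move: ly yl; clear; move: (index y P) => i; lia.
Qed.

(** The last vertex of [P] gets the default [v0]; a neighbour of a vertex off [P] is never the last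
    one. *)
Definition path_succ y := v (index y P).+1.

Lemma path_succ_inj x : x \notin P -> {in path_nbrs x &, injective path_succ}.
Proof.
move=> xP y z yN zN /eqP.
have [yi yE /(nbr_interior xP yi)[_ yi1]] := path_nbrs_nth yN.
have [zi zE /(nbr_interior xP zi)[_ zi1]] := path_nbrs_nth zN.
by rewrite nth_uniq // eqSS => /eqP E; rewrite -yE -zE E.
Qed.

(** Two such vertices would produce the longer path of [nbr_not_crossing]. *)
Lemma card_path_succ x x' : x \notin P -> x' \notin P -> x != x' ->
  #|[set y in path_succ @: path_nbrs x | adj x' y]| <= 1.
Proof.
move=> xP x'P xx'; rewrite leqNgt; apply/negP=> /card_gt1P[y1 [y2 []]].
rewrite inE => /andP[/imsetP[w1 w1N ->] a1]; rewrite inE => /andP[/imsetP[w2 w2N ->] a2] ne.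
wlog lt : w1 w2 w1N w2N a1 a2 ne / index w1 P < index w2 P.
  move=> H; case: (ltngtP (index w1 P) (index w2 P)) => [/H|/H|E]; first by apply.
    by apply; rewrite // eq_sym.
  by move: ne; rewrite /path_succ E eqxx.
have [i1 E1 x1] := path_nbrs_nth w1N; have [i2 E2 x2] := path_nbrs_nth w2N.
have [_ i2'] := nbr_interior xP i2 x2.
by have := nbr_not_crossing xP x'P xx' lt i2' x1 x2 a1; rewrite a2.
Qed.

Lemma not_adj_first x : 0 < p -> x \notin P -> ~~ adj x (v 0).
Proof. by move=> p0 xP; apply/negP=> /(nbr_interior xP p0)[]. Qed.

Lemma not_adj_last x : 0 < p -> x \notin P -> ~~ adj x (v p.-1).
Proof.
move=> p0 xP; apply/negP=> /(nbr_interior xP); rewrite ltn_predL p0 => /(_ isT)[_].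
by rewrite prednK // ltnn.
Qed.

(** The first vertex of [P] is the hub, and the last one is joined to all of [A] in the complement.
    The set [X] supplies further vertices of the cycle when [P] alone is too short. *)
Lemma jahangir_of_outer_degree (A X : {set F}) m d :
  1 < m -> 1 < p -> #|A| = m -> {in A, forall a, a \notin P} ->
  {in X, forall x, x \notin P} -> [disjoint A & X] ->
  {in A & X, forall a x, ~~ adj a x} ->
  {in A, forall a, #|path_nbrs a| <= d} ->
  d + m <= p.-1 + #|X| -> 2 * d + 2 <= p.-1 + #|X| ->
  contains (complement F) (jahangir m).
Proof.
move=> m1 p1 cA AP XP dAX noAX deg le1 le2; have p0 := ltnW p1.
have hP : v 0 \in P by apply: mem_nth.
have uIP : v p.-1 \in P by apply: mem_nth; rewrite prednK.
have uh : v p.-1 != v 0 by rewrite nth_uniq ?prednK // -lt0n -subn1 subn_gt0.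
pose B := ([set y in P] :\ v 0) :|: X.
have cB : #|B| = p.-1 + #|X|.
  rewrite cardsU (_ : _ :&: X = set0) ?cards0 ?subn0; last first.
    by apply/setP=> z; rewrite !inE; case zX: (z \in X); rewrite ?andbF // (negbTE (XP z zX)) andbF.
  congr (_ + _); have := cardsD1 (v 0) [set y in P].
  by rewrite inE hP cardsE (card_uniqP uP) => ->.
apply: (@jahangir_of_degree F A B m d (v 0) (v p.-1)); rewrite ?cB //.
- apply/pred0P=> z /=; case zA: (z \in A) => //=; rewrite !inE (negbTE (AP z zA)) andbF /=.
  by rewrite (disjointFr dAX zA).
- by apply: contraTN hP => /AP.
- by rewrite !inE eqxx /=; apply: contraTN hP => /XP.
- by rewrite !inE uh uIP.
- by move=> a /AP aP; rewrite adj_sym not_adj_first.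
- by move=> a /AP aP; rewrite not_adj_last.
move=> a aA; apply: leq_trans (deg a aA); apply: subset_leq_card; apply/subsetP=> y.
rewrite !inE => /andP[/orP[/andP[_ ->] //|yX] ay].
by move: (noAX _ _ aA yX); rewrite ay.
Qed.

(* In the exceptional situation that all of A \ {x} is joined to one vertex of
   R, that vertex is exchanged for its neighbour on P adjacent to x. *)
Lemma jahangir_of_fan (A R : {set F}) m x u :
  2 < m -> 0 < p -> #|A| = m -> {in A, forall a, a \notin P} -> x \in A ->
  u \notin A -> u != v 0 -> {in A, forall a, ~~ adj a u} ->
  {in R, forall y, exists i, [/\ 0 < i, i < p & y = v i]} ->
  {in R, forall y, ~~ adj x y} ->
  {in A :\ x, forall a, #|[set y in R | adj a y]| <= 1} ->
  {in R, forall y, exists i, i.+1 < p /\ ((y = v i /\ adj x (v i.+1)) \/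
                                            (y = v i.+1 /\ adj x (v i)))} ->
  m <= #|u |: R| ->
  contains (complement F) (jahangir m).
Proof.
move=> m2 p0 cA AP xA uA uh au RP xR deg near leR.
(* One of the [m] places is reserved for [u]. *)
have [R0 R0s cR0] : exists2 R0 : {set F}, R0 \subset R :\ u & #|R0| = m.-1.
  apply: subset_of_card; move: leR; rewrite cardsU1; have := cardsD1 u R.
  by move: (u \in R) => b; clear -m2; move: #|R| #|R :\ u|; case: b; lia.
have R0R y : y \in R0 -> y \in R by move/(subsetP R0s); rewrite inE => /andP[].
have uR0 : u \notin R0 by apply/negP=> /(subsetP R0s); rewrite !inE eqxx.
have RinP y : y \in R -> y \in P by case/RP=> i [_ ip ->]; apply: mem_nth.
have hP : v 0 \in P by apply: mem_nth.
have cA1 : #|A :\ x| = m.-1 by have := cardsD1 x A; rewrite xA cA; clear; lia.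
have hR0 : v 0 \notin R0.
  apply/negP=> /R0R/RP[i [i0 ip /eqP]]; rewrite nth_uniq //; by case: i i0 {ip}.
have [a1 a1A] : exists a, a \in A :\ x by apply/card_gt0P; rewrite cA1; move: m2; clear; lia.
apply: (@jahangir_of_few_missing F A (u |: R0) m x (v 0) u) => //.
- by rewrite cardsU1 uR0 cR0; move: m2; clear; lia.
- apply/pred0P=> z /=; case zA: (z \in A) => //=; rewrite !inE.
  apply/negP=> /orP[/eqP zu | /R0R/RinP zP]; first by move: uA; rewrite -zu zA.
  by move: (AP z zA); rewrite zP.
- by apply: contraTN hP => /AP.
- by rewrite !inE negb_or eq_sym uh.
- by move=> y /setU1P[-> | /R0R/xR]; first exact: au.
- by rewrite setU11.
- by move=> a /AP aP; rewrite adj_sym not_adj_first.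
- move=> a aA; have [->|ax] := eqVneq a x.
    rewrite (_ : [set _ in _ | _] = set0) ?cards0 //; apply/setP=> z; rewrite [LHS]inE in_set0.
    apply/negP=> /andP[/setU1P[->|/R0R zR]]; last by rewrite (negbTE (xR z zR)).
    by rewrite (negbTE (au x xA)).
  have aAx : a \in A :\ x by rewrite !inE ax.
  apply: leq_trans (deg a aAx); apply: subset_leq_card; apply/subsetP=> z.
  rewrite inE => /andP[/setU1P[->|/R0R zR] az]; last by rewrite inE zR.
  by move: az; rewrite (negbTE (au a aA)).
move=> y /setU1P[->|yR0].
  by left; exists a1 => //; apply: au; move: a1A; rewrite inE => /andP[].
have [/existsP[a /andP[aA ay]]|/existsPn nex] := boolP [exists a in A :\ x, ~~ adj a y].
  by left; exists a.
have ady a : a \in A :\ x -> adj a y by move=> aA; have := nex a; rewrite aA negbK.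
have inA a : a \in A :\ x -> a \in A by rewrite inE => /andP[].
right; have [i [ip yw]] := near y (R0R _ yR0); have ip' := ltnW ip.
(* A neighbour [w] of [x] on [P] is always new, because [x] is adjacent neither to [u], nor to [R],
   nor to the hub. *)
have fin w : w \in P -> adj x w -> {in A :\ x, forall a, ~~ adj a w} ->
    exists y', [/\ y' \notin A, y' \notin u |: R0, y' != v 0 & {in A :\ x, forall a, ~~ adj a y'}].
  move=> wP xw aw; exists w; split=> //.
  - by apply: contraTN wP => /AP.
  - apply/negP=> /setU1P[wu|/R0R/xR]; last by rewrite xw.
    by move: (au x xA); rewrite -wu xw.
  - by apply: contraTneq xw => ->; rewrite not_adj_first // AP.
(* Since [y] and [w] are consecutive on [P] and every [a] in [A :\ x] is adjacent to [y], none of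
   them is adjacent to [w]. *)
case: yw => -[ye xw].
  apply: (fin (v i.+1)) => //; first by apply: mem_nth.
  move=> a aA; apply: (nbr_not_consecutive) => //; first by apply: AP; apply: inA.
  by rewrite -ye ady.
apply: (fin (v i)) => //; first by apply: mem_nth.
move=> a aA; apply/negP=> ai; have := nbr_not_consecutive (AP a (inA a aA)) ip ai.
by rewrite -ye ady.
Qed.

(** The successors of the neighbours of [x] can serve as [R]: [x] is adjacent to none of them, and
    every other vertex of [A] to at most one. *)
Lemma jahangir_of_fan_succ (A : {set F}) m x u :
  2 < m -> 0 < p -> #|A| = m -> {in A, forall a, a \notin P} -> x \in A ->
  u \notin A -> u != v 0 -> {in A, forall a, ~~ adj a u} ->
  m <= #|u |: path_succ @: path_nbrs x| ->
  contains (complement F) (jahangir m).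
Proof.
move=> m2 p0 cA AP xA uA uh au; have xP := AP x xA.
have R_nth y : y \in path_succ @: path_nbrs x -> exists i,
    [/\ i.+1 < p, y = v i.+1 & adj x (v i)].
  case/imsetP=> w wN ->; have [wi wE xw] := path_nbrs_nth wN; exists (index w P); split=> //.
  by have [] := nbr_interior xP wi xw.
apply: (@jahangir_of_fan A (path_succ @: path_nbrs x) m x u) => //.
- by move=> y /R_nth[i [ip -> _]]; exists i.+1.
- by move=> y /R_nth[i [ip -> xi]]; apply: (nbr_not_consecutive).
- move=> a; rewrite !inE => /andP[ax aA].
  by apply: (card_path_succ) => //; [exact: AP | rewrite eq_sym].
by move=> y /R_nth[i [ip -> xi]]; exists i; split; [|right].
Qed.

(** * Cases by the length of the longest path *)

Lemma jahangir_long_path (Q : {set F}) m :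
  2 < m -> 2 * m < p -> #|Q| = m -> {in Q, forall x, x \notin P} ->
  contains (complement F) (jahangir m).
Proof.
move=> m2 mp cQ QP; have p0 : 0 < p by move: mp; clear; lia.
have [/forallP low|/forallPn[x]] := boolP [forall x, (x \in Q) ==> (#|path_nbrs x| <= m.-1)].
  (* Both inequalities hold for [d = m - 1] because [2 * m <= p - 1]. *)
  apply: (@jahangir_of_outer_degree Q set0 m m.-1) => //; rewrite ?cards0 ?addn0.
  - by lia.
  - by move: mp m2; clear; lia.
  - by move=> x; rewrite inE.
  - by rewrite disjoint_sym; apply/pred0P=> z; rewrite !inE.
  - by move=> a x _; rewrite inE.
  - by move=> x xQ; have := low x; rewrite xQ.
  - by move: mp m2; clear; lia.
  - by move: mp m2; clear; lia.
rewrite negb_imply -ltnNge => /andP[xQ big].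
have uIP : v p.-1 \in P by apply: mem_nth; rewrite prednK.
apply: (@jahangir_of_fan_succ Q m x (v p.-1)) => //.
- by apply: contraTN uIP => /QP.
- by rewrite nth_uniq ?prednK //; move: mp m2; clear; lia.
- by move=> a /QP aP; apply: not_adj_last.
apply: leq_trans (subset_leq_card (subsetUr _ _)).
rewrite card_in_imset; first by move: big m2; clear; lia.
exact: (path_succ_inj (QP x xQ)).
Qed.

Lemma jahangir_path_2m_minus_1 (Q : {set F}) m :
  2 < m -> p = (2 * m).-1 -> #|Q| = m.+1 -> {in Q, forall x, x \notin P} ->
  contains (complement F) (jahangir m).
Proof.
move=> m2 pE cQ QP; have p0 : 0 < p by move: pE m2; clear; lia.
(* Here [m - 1] is the largest possible number of neighbours on [P]. If at most one vertex attains
   it, [m] others satisfy the degree condition with [d = m - 2]. *)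
pose Full := [set x in Q | m.-1 <= #|path_nbrs x|].
have [le1|/card_gt1P[x1 [x2 []]]] := leqP #|Full| 1.
  have [A As cA] : exists2 A : {set F}, A \subset Q :\: Full & #|A| = m.
    apply: subset_of_card; have := cardsID Full Q; have := subset_leq_card (subsetIr Q Full).
    by rewrite cQ; move: le1; clear; lia.
  have AQ a : a \in A -> (a \in Q) && (#|path_nbrs a| < m.-1).
    by move/(subsetP As); rewrite !inE => /andP[+ aQ]; rewrite aQ -ltnNge.
  apply: (@jahangir_of_outer_degree A set0 m m.-2) => //; rewrite ?cards0 ?addn0.
  - by lia.
  - by move: pE m2; clear; lia.
  - by move=> a /AQ/andP[/QP].
  - by move=> x; rewrite inE.
  - by rewrite disjoint_sym; apply/pred0P=> z; rewrite !inE.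
  - by move=> a x _; rewrite inE.
  - by move=> a /AQ/andP[_]; move: m2; clear; move: #|path_nbrs a|; lia.
  - by move: pE m2; clear; lia.
  - by move: pE m2; clear; lia.
rewrite !inE => /andP[x1Q f1] /andP[x2Q f2] x12.
(* A neighbour [y] of [x1] in [Q] would keep the neighbours of [x1] on [P] two places away from both
   ends, leaving at most [m - 2] of them. *)
have iso y : y \in Q -> ~~ adj x1 y.
  move=> yQ; apply/negP=> xy; have := card_path_nbrs (QP _ x1Q) (l := 2).
  suff rg : {in path_nbrs x1, forall w, 2 <= index w P /\ index w P + 2 < p}.
    by move/(_ rg); move: f1 pE m2; clear; move: #|path_nbrs x1|; lia.
  move=> w wN; have [wi wE xw] := path_nbrs_nth wN.
  apply: (nbr_of_outer_path (x := x1) (w := [:: y])) => //.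
  - by rewrite /= inE andbT; apply: contraTneq xy => ->; rewrite adj_irrefl.
  - by rewrite /= xy.
  - by move=> z; rewrite !inE => /orP[] /eqP ->; apply: QP.
(* The successors obtained from [x2] may number only [m - 1]; [x1], having no neighbour in [Q],
   provides the missing vertex. *)
apply: (@jahangir_of_fan_succ (Q :\ x1) m x2 x1) => //.
- by have := cardsD1 x1 Q; rewrite x1Q cQ; clear; lia.
- by move=> a; rewrite inE => /andP[_ /QP].
- by rewrite !inE eq_sym x12.
- by rewrite !inE eqxx.
- by apply: contraNneq (QP _ x1Q) => ->; apply: mem_nth.
- by move=> a; rewrite inE => /andP[_ /iso]; rewrite adj_sym.
rewrite cardsU1 card_in_imset; last exact: (path_succ_inj (QP x2 x2Q)).
suff -> : x1 \notin path_succ @: path_nbrs x2 by move: f2 m2; clear; move: #|path_nbrs x2|; lia.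
apply: contra (QP _ x1Q) => /imsetP[w /path_nbrs_nth[wi wE xw] ->].
by apply: mem_nth; have [] := nbr_interior (QP _ x2Q) wi xw.
Qed.

Lemma jahangir_path_2m (Q : {set F}) m :
  2 < m -> p = 2 * m -> #|Q| = m -> {in Q, forall x, x \notin P} ->
  contains (complement F) (jahangir m).
Proof.
move=> m2 pE cQ QP; have p0 : 0 < p by move: pE m2; clear; lia.
have [/forallP low|/forallPn[x]] := boolP [forall x, (x \in Q) ==> (#|path_nbrs x| <= m.-2)].
  apply: (@jahangir_of_outer_degree Q set0 m m.-2) => //; rewrite ?cards0 ?addn0.
  - by lia.
  - by move: pE m2; clear; lia.
  - by move=> x; rewrite inE.
  - by rewrite disjoint_sym; apply/pred0P=> z; rewrite !inE.
  - by move=> a x _; rewrite inE.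
  - by move=> x xQ; have := low x; rewrite xQ.
  - by move: pE m2; clear; lia.
  - by move: pE m2; clear; lia.
rewrite negb_imply -ltnNge => /andP[xQ big]; have xP := QP x xQ.
have rg y : y \in path_nbrs x -> 1 <= index y P /\ index y P + 1 < p.
  move=> /path_nbrs_nth[yi yE xy]; have [] := nbr_interior xP yi xy.
  by rewrite addn1.
have rg1 y : y \in path_nbrs x -> 1 <= index y P by case/rg.
have cN : #|path_nbrs x| = m.-1.
  have := card_path_nbrs xP rg; move: big pE m2; clear.
  by move: #|path_nbrs x|; lia.
pose N i := (i < p) && adj x (v i).
(* The half-indices of the [m - 1] neighbours are distinct numbers below [m - 1], so each value
   occurs and each pair of positions contains a neighbour. *)
have pair k : k < m.-1 -> N (2 * k).+1 || N (2 * k).+2.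
  move=> km; pose g y := (index y P - 1)./2.
  have us : uniq (map g (enum (path_nbrs x))).
    rewrite map_inj_in_uniq ?enum_uniq // => y z; rewrite !mem_enum.
    exact: (half_index_inj xP rg1).
  have : k \in map g (enum (path_nbrs x)).
    have sub : {subset map g (enum (path_nbrs x)) <= iota 0 m.-1}.
      move=> w /mapP[y]; rewrite mem_enum => /rg[ly yl] ->; rewrite mem_iota /g.
      by move: ly yl pE; clear; move: (index y P) => i; lia.
    have [|_ ->] := uniq_min_size us sub; first by rewrite size_iota size_map -cardE cN.
    by rewrite mem_iota.
  case/mapP=> y; rewrite mem_enum => yN kE; have [ly _] := rg y yN.
  have [yi _ xy] := path_nbrs_nth yN.
  have Ny : N (index y P) by rewrite /N yi xy.
  have [E|E] : index y P = (2 * k).+1 \/ index y P = (2 * k).+2.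
    by move: ly; rewrite kE /g; clear; move: (index y P) => i; lia.
  - by rewrite -E Ny.
  - by rewrite -E Ny orbT.
have nc i : i.+1 < 2 * m -> N i -> ~~ N i.+1.
  rewrite -pE => ip /andP[_ xi]; apply/negP=> /andP[_].
  by rewrite (negbTE (nbr_not_consecutive xP ip xi)).
have spread := dense_nonconsecutive pair nc.
have uIP : v p.-1 \in P by apply: mem_nth; rewrite prednK.
have hP : v 0 \in P by apply: mem_nth.
have uh : v p.-1 != v 0 by rewrite nth_uniq ?prednK //; move: pE m2; clear; lia.
(* The successors might include the last vertex of [P], which is already taken as [u]; the
   non-neighbours of [x] strictly inside [P] replace them. *)
pose R := [set y in P] :\ v 0 :\ v p.-1 :\: path_nbrs x.
have R_nth y : y \in R -> exists i, [/\ i.+2 < p, y = v i.+1, ~~ N i.+1 & index y P = i.+1].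
  rewrite !inE => /and4P[yN yu y0 yP]; move: (yP) => yi; rewrite -index_mem in yi.
  have yE := nth_index v0 yP; rewrite yP /= -{1}yE in yN.
  exists (index y P).-1.
  have i0 : 0 < index y P by rewrite lt0n; apply: contraNneq y0 => E; rewrite -E yE.
  rewrite prednK // yE /N yi yN; split=> //; rewrite ltn_neqAle yi andbT.
  by apply: contraNneq yu => <-; rewrite yE.
have cR : #|R| = m.-1.
  rewrite /R cardsD (setIidPr _); last first.
    apply/subsetP=> y yN; have [yi yE xy] := path_nbrs_nth yN; rewrite -yE.
    have [i0 i1] := nbr_interior xP yi xy.
    rewrite !inE mem_nth // !nth_uniq ?prednK // andbT -lt0n i0 andbT.
    by apply: contraTneq i1 => ->; rewrite prednK // ltnn.
  have cP : #|[set y in P]| = p by rewrite cardsE (card_uniqP uP).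
  have := cardsD1 (v 0) [set y in P]; have := cardsD1 (v p.-1) ([set y in P] :\ v 0).
  rewrite !inE uh hP uIP cP cN pE; move: m2; clear.
  by move: #|_ :\ _ :\ _| #|_ :\ _|; lia.
apply: (@jahangir_of_fan Q R m x (v p.-1)) => //.
- by apply: contraTN uIP => /QP.
- by move=> a /QP aP; apply: (not_adj_last).
- by move=> y /R_nth[i [ip -> _ _]]; exists i.+1; split=> //; apply: ltnW.
- by move=> y /R_nth[i [ip -> + _]]; rewrite /N (ltnW ip).
- move=> a; rewrite inE => /andP[]; rewrite inE => ax aQ; have aP := QP a aQ.
  have xa : x != a by rewrite eq_sym.
  rewrite leqNgt; apply/negP=> /card_gt1P[y [z []]].
  rewrite inE => /andP[/R_nth[i [ip -> Ni _]] ai]; rewrite inE => /andP[/R_nth[j [jp -> Nj _]] aj] ne.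
  wlog ij : i j ip jp Ni Nj ai aj ne / i < j.
    move=> H; case: (ltngtP i j) => [ij|ij|E]; first exact: (H i j).
      by apply: (H j i) => //; rewrite eq_sym.
    by move: ne; rewrite E eqxx.
  (* Consecutive positions cannot both be adjacent to [a]. In the other two patterns the neighbours
     of [x] just before, or just after, the two positions give a crossing. *)
  have := spread i j ij; rewrite -pE => /(_ jp Ni Nj)[E|[/andP[_ Ni0] /andP[_ Nj0]]|[/andP[_ Ni2] /andP[_ Nj2]]].
  + by have := nbr_not_consecutive aP ip ai; rewrite -E aj.
  + by have := nbr_not_crossing xP aP xa ij (ltnW jp) Ni0 Nj0 ai; rewrite aj.
  + have ij1 : i.+1 < j.+1 by [].
    by have := nbr_not_crossing aP xP ax ij1 jp ai aj Ni2; rewrite Nj2.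
- move=> y /R_nth[i [ip yE Ni _]].
  have := pair i./2; rewrite (_ : i./2 < m.-1); last by move: ip; rewrite pE; clear; lia.
  move=> /(_ isT); have [oi|oi] := boolP (odd i).
    rewrite (_ : (2 * i./2).+1 = i) ?(negbTE Ni) ?orbF; last by move: oi; clear; lia.
    by move=> /andP[_ xi]; exists i; split; [exact: ltnW | right].
  rewrite (_ : 2 * i./2 = i) ?(negbTE Ni) /=; last by move: oi; clear; lia.
  by move=> /andP[_ xi]; exists i.+1; split; [| left].
rewrite cardsU1 !inE eqxx /= andbF cR; move: m2; clear; lia.
Qed.

Lemma jahangir_short_path (Q : {set F}) m :
  2 < m <= 5 -> m < p -> p.+1 < 2 * m -> #|Q| + p = 3 * m -> {in Q, forall x, x \notin P} ->
  contains (complement F) (jahangir m).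
Proof.
move=> /andP[m2 m5] mp pm cQ QP.
have p1 : 1 < p by move: mp m2; clear; lia.
have m1 : 1 < m by lia.
have deg l x w : x \in Q -> uniq (x :: w) -> sorted (@adj F) (x :: w) -> {subset w <= Q} ->
    (size w).+1 = l -> #|path_nbrs x| <= uphalf (p - 2 * l).
  move=> xQ uw sw wQ lE; apply: (card_path_nbrs (QP x xQ)) => y.
  move=> /path_nbrs_nth[yi _ xy]; rewrite -lE.
  apply: (nbr_of_outer_path (x := x) (w := w)) => //.
  by move=> z; rewrite inE => /orP[/eqP->|/wQ]; apply: QP.
have deg1 x : x \in Q -> #|path_nbrs x| <= uphalf (p - 2 * 1).
  by move=> xQ; apply: (deg 1 x [::]).
have neq (x y : F) : adj x y -> x != y by move=> xy; apply: contraTneq xy => ->; rewrite adj_irrefl.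
have deg2 x y : x \in Q -> y \in Q -> adj x y -> #|path_nbrs x| <= uphalf (p - 2 * 2).
  move=> xQ yQ xy; apply: (deg 2 x [:: y]); rewrite //= ?xy // ?inE ?neq //.
  by move=> z; rewrite inE => /eqP->.
have deg3 x y z : x \in Q -> y \in Q -> z \in Q -> adj x y -> adj y z -> z != x ->
    #|path_nbrs x| <= uphalf (p - 2 * 3).
  move=> xQ yQ zQ xy yz zx; apply: (deg 3 x [:: y; z]); rewrite //= ?xy ?yz //.
    by rewrite !inE negb_or (neq x y xy) (neq y z yz) eq_sym zx.
  by move=> w; rewrite !inE => /orP[] /eqP->.
have outer (A X : {set F}) d : A \subset Q -> X \subset Q -> #|A| = m -> [disjoint A & X] ->
    {in A & X, forall a x, ~~ adj a x} -> {in A, forall a, #|path_nbrs a| <= d} ->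
    d + m <= p.-1 + #|X| -> 2 * d + 2 <= p.-1 + #|X| -> contains (complement F) (jahangir m).
  move=> /subsetP AQ /subsetP XQ cA dAX noAX dA le1 le2.
  apply: (@jahangir_of_outer_degree A X m d) => //.
    by move=> a /AQ/QP.
  by move=> a /XQ/QP.
have split_off (X B : {set F}) d : X \subset Q -> B \subset Q -> [disjoint B & X] ->
    m <= #|B| -> {in B & X, forall a x, ~~ adj a x} -> {in B, forall a, #|path_nbrs a| <= d} ->
    d + m <= p.-1 + #|X| -> 2 * d + 2 <= p.-1 + #|X| -> contains (complement F) (jahangir m).
  move=> XQ BQ dBX mB noBX dB; have [A AB cA] := subset_of_card mB.
  apply: (outer A X d) => //; first exact: subset_trans BQ.
  - exact: disjointWl dBX.
  - by move=> a x /(subsetP AB); apply: noBX.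
  - by move=> a /(subsetP AB); apply: dB.
pose Z := [set x in Q | [forall y in Q, ~~ adj x y]].
have ZQ : Z \subset Q by apply/subsetP=> x; rewrite inE => /andP[].
have Ziso x y : x \in Z -> y \in Q -> ~~ adj x y.
  by rewrite inE => /andP[_ /forallP/(_ y)] + yQ; rewrite yQ.
have nZ x : x \in Q -> x \notin Z -> exists2 y, y \in Q & adj x y.
  by rewrite !inE => -> /= /forallPn[y]; rewrite negb_imply negbK => /andP[]; exists y.
(* If [Z] is large, [2 * m - p] of its vertices join the cycle and exactly [m] vertices of [Q]
   remain for [A]. *)
have [ZS|ZS] := leqP (2 * m - p) #|Z|.
  have [X XZ cX] := subset_of_card ZS.
  have XQ := subset_trans XZ ZQ.
  apply: (split_off X (Q :\: X) (uphalf (p - 2 * 1))) => //; rewrite ?cX ?subsetDl //.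
  - by rewrite disjoint_sym disjoints_subset; apply/subsetP=> z; rewrite !inE => ->.
  - have := cardsID X Q; rewrite (setIidPr XQ) cX; move: cQ pm; clear.
    by move: #|Q| #|Q :\: X|; lia.
  - move=> a x; rewrite inE => /andP[_ aQ] /(subsetP XZ) xZ.
    by rewrite adj_sym; apply: Ziso.
  - by move=> a; rewrite inE => /andP[_ /deg1].
  - by move: pm mp; clear; lia.
  - by move: pm mp; clear; lia.
have cQZ : #|Q :\: Z| + #|Z| = #|Q| by rewrite addnC -(cardsID Z Q) (setIidPr ZQ).
have [Zok|Z0] : (0 < #|Z| \/ p = 2 * m - 2) \/ (#|Z| = 0 /\ p < 2 * m - 2).
  by move: pm; clear; move: #|Z|; lia.
  (* Every vertex outside [Z] has a neighbour in [Q], which improves its degree bound. *)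
  apply: (split_off Z (Q :\: Z) (uphalf (p - 2 * 2))) => //; rewrite ?subsetDl //.
  - by rewrite disjoint_sym disjoints_subset; apply/subsetP=> z; rewrite !inE => ->.
  - by move: cQ cQZ ZS pm; clear; move: #|Z| #|Q| #|Q :\: Z|; lia.
  - by move=> a x; rewrite inE => /andP[_ aQ] xZ; rewrite adj_sym; apply: Ziso.
  - move=> a; rewrite inE => /andP[aZ aQ]; have [y yQ ay] := nZ a aQ aZ.
    exact: deg2 ay.
  - by move: Zok ZS pm mp m5; clear; move: #|Z|; lia.
  - by move: Zok ZS pm mp m5; clear; move: #|Z|; lia.
case: Z0 => /eqP; rewrite cards_eq0 => /eqP Z0 pm2.
have nb x : x \in Q -> exists2 y, y \in Q & adj x y.
  by move=> xQ; apply: nZ; rewrite // Z0 inE.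
(* A path on three vertices in [Q] improves the degree bound of its first vertex once more. A vertex
   of [Q] outside [V3] is the centre of a star that is a component of the graph on [Q]. *)
pose V3 := [set x in Q | [exists y in Q, exists z in Q, [&& adj x y, adj y z & z != x]]].
have V3P x y z : x \in Q -> y \in Q -> z \in Q -> adj x y -> adj y z -> x \notin V3 -> z = x.
  move=> xQ yQ zQ xy yz; apply: contraNeq => zx; rewrite inE xQ; apply/existsP; exists y.
  by rewrite yQ; apply/existsP; exists z; rewrite zQ xy yz.
have V3Q : V3 \subset Q by apply/subsetP=> x; rewrite inE => /andP[].
have [le3|lt3] := leqP m #|V3|.
  apply: (split_off set0 V3 (uphalf (p - 2 * 3))); rewrite ?sub0set ?cards0 ?addn0 //.
  - by rewrite disjoint_sym; apply/pred0P=> z; rewrite !inE.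
  - by move=> a x _; rewrite inE.
  - move=> x; rewrite inE => /andP[xQ /existsP[y /andP[yQ /existsP[z /andP[zQ]]]]].
    by case/and3P=> xy yz zx; apply: (deg3 x y z).
  - by move: pm2 mp m5; clear; lia.
  - by move: pm2 mp m5; clear; lia.
pose star x := x |: [set y in Q | adj x y].
have starQ x : x \in Q -> star x \subset Q.
  by move=> xQ; apply/subsetP=> y /setU1P[->//|]; rewrite inE => /andP[].
have cQ3 : #|Q :\: V3| + #|V3| = #|Q| by rewrite addnC -(cardsID V3 Q) (setIidPr V3Q).
(* A star component with at most [2 * m - p] vertices has no edges to the rest of [Q] and can be
   used as [X]. *)
have [/existsP[x /andP[]]|/existsPn nsmall] := boolP [exists x in Q :\: V3, #|star x| <= 2 * m - p].
  rewrite inE => /andP[xV3 xQ] small; have [y0 y0Q xy0] := nb x xQ.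
  have big : 1 < #|star x|.
    by apply/card_gt1P; exists x, y0; rewrite !inE eqxx y0Q xy0 orbT neq.
  apply: (split_off (star x) (Q :\: star x) (uphalf (p - 2 * 2))); rewrite ?subsetDl ?starQ //.
  - by rewrite disjoint_sym disjoints_subset; apply/subsetP=> z; rewrite !inE => ->.
  - have := cardsID (star x) Q; rewrite (setIidPr (starQ x xQ)).
    by move: cQ small pm; clear; move: #|Q| #|star x| #|_ :\: _|; lia.
  - move=> a y; rewrite !inE negb_or => /andP[/andP[ax]] + aQ.
    rewrite aQ /= => xa /orP[/eqP->|/andP[yQ xy]]; first by rewrite adj_sym.
    by apply: contra ax => ay; apply/eqP; apply: (V3P x y a) => //; rewrite adj_sym.
  - by move=> a; rewrite inE => /andP[_ aQ]; have [y yQ ay] := nb a aQ; apply: deg2 ay.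
  - by move: big pm2 pm mp m5; clear; move: #|star x|; lia.
  - by move: big pm2 pm mp m5; clear; move: #|star x|; lia.
have big x : x \in Q :\: V3 -> 4 <= #|star x|.
  by move=> xV; have := nsmall x; rewrite xV -ltnNge /=; move: pm2; clear; move: #|star x|; lia.
(* The remaining stars have at least four vertices and are pairwise disjoint. Hence at least three
   quarters of [Q] lie in [V3], which for [m <= 5] contradicts [#|V3| < m]. *)
have : 4 * #|Q :\: V3| <= #|Q|.
  rewrite mulnC -sum_nat_const.
  apply: leq_trans (_ : \sum_(x in Q :\: V3) #|star x| <= _); first exact: leq_sum.
  have -> : \sum_(x in Q :\: V3) #|star x| = \sum_(y in Q) #|[set x in Q :\: V3 | y \in star x]|.
    transitivity (\sum_(x in Q :\: V3) \sum_(y in Q) (y \in star x)).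
      apply: eq_bigr => x; rewrite inE => /andP[_ xQ]; rewrite -sum1_card big_mkcond [RHS]big_mkcond /=.
      apply: eq_bigr => y _; case yS: (y \in star x); last by case: ifP.
      by rewrite (subsetP (starQ x xQ) y yS).
    rewrite exchange_big; apply: eq_bigr => y _.
    rewrite -sum1_card big_mkcond [RHS]big_mkcond /=.
    by apply: eq_bigr => x _; rewrite [in RHS]inE; case: (x \in _); case: (y \in _).
  rewrite -sum1_card; apply: leq_sum => y yQ; rewrite leqNgt; apply/negP=> /card_gt1P[x [x' []]].
  rewrite inE => /andP[xV yx]; rewrite inE => /andP[x'V yx'] xx'.
  have no_edge u w : u \in Q :\: V3 -> w \in Q :\: V3 -> ~~ adj u w.
    move=> uV wV; apply/negP=> uw; move: (uV) (wV); rewrite !in_setD => /andP[_ uQ] /andP[wV3 wQ].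
    have : #|star u| <= #|[set u; w]|.
      apply: subset_leq_card; apply/subsetP=> z /setU1P[->|]; first by rewrite !inE eqxx.
      rewrite inE => /andP[zQ uz]; rewrite !inE; apply/orP; right; apply/eqP.
      by apply: (V3P w u z) => //; rewrite adj_sym.
    by have := big u uV; rewrite cards2; case: (_ != _); clear; move: #|star u|; lia.
  move: (no_edge x x' xV x'V) (no_edge x' x x'V xV) => nxx' nx'x.
  case/setU1P: yx => [yE|]; case/setU1P: yx' => [yE'|]; rewrite ?inE.
  - by move: xx'; rewrite -yE -yE' eqxx.
  - by rewrite yE (negbTE nx'x) andbF.
  - by rewrite yE' (negbTE nxx') andbF.
  move=> /andP[_ x'y] /andP[_ xy]; move: xV x'V; rewrite !in_setD => /andP[xV3 xQ] /andP[_ x'Q].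
  by move: xx'; rewrite (V3P x y x') ?eqxx // adj_sym.
by move: lt3 cQ3 cQ pm2 mp m5; clear; move: #|V3| #|Q| #|_ :\: _|; lia.
Qed.

End LongestPath.

(** * Upper and lower bound *)

Lemma exists_longest_path (F : sgraph) :
  exists P : seq F, [/\ uniq P, sorted (@adj F) P &
    forall s : seq F, uniq s -> sorted (@adj F) s -> size s <= size P].
Proof.
pose has_path k := [exists t : k.-tuple F, uniq t && sorted (@adj F) t].
have ex : exists k, has_path k.
  by exists 0; apply/existsP; exists [tuple].
have bd k : has_path k -> k <= #|F|.
  by case/existsP=> t /andP[ut _]; rewrite -(size_tuple t) -(card_uniqP ut) max_card.
case: (ex_maxnP ex bd) => k /existsP[t /andP[ut st]] maxk.
exists t; split=> // s us ss; rewrite size_tuple; apply: maxk.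
by apply/existsP; exists (in_tuple s); rewrite us ss.
Qed.

Lemma path_or_jahangir (F : sgraph) m n :
  2 < m -> (m <= 5 -> 2 * m + 1 <= n) -> (6 <= m -> (4 * m - 1) * (m - 1) + 1 <= n) ->
  n + m - 1 <= #|F| ->
  (exists s : seq F, [/\ uniq s, sorted (@adj F) s & size s = n]) \/
  contains (complement F) (jahangir m).
Proof.
move=> m2 small large leF; have [P [uP sP maxP]] := exists_longest_path F.
have [np|pn] := leqP n (size P).
  by left; exists (take n P); split; rewrite ?take_uniq ?take_sorted // size_takel.
(* The first case means that at least [2 * m] vertices lie off [P]. Of the [m + 1] vertices on one
   side of the hole, one becomes the hub. *)
right; pose p := size P; have [far|near] := leqP (m + m.+1 + p) #|F|.+1.
  have [||S [T [dST cS cT noST]]] := bipartite_hole maxP _ _ far; [by lia | by [] |].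
  have /card_gt0P[h hT] : 0 < #|T| by apply: leq_trans cT.
  have cT' : m <= #|T :\ h| by move: cT; rewrite (cardsD1 h) hT.
  have /card_gt0P[u uT] : 0 < #|T :\ h| by apply: leq_trans cT'; apply: ltnW; apply: ltnW.
  have dST' : [disjoint S & T :\ h] by apply: disjointWr dST; apply: subD1set.
  apply: (@jahangir_of_degree F S (T :\ h) m 0 h u) => //.
  - exact: ltnW.
  - by rewrite (disjointFl dST).
  - by rewrite !inE eqxx.
  - by move=> a aS; rewrite adj_sym noST.
  - by move=> a aS; apply: noST => //; move: uT; rewrite inE => /andP[].
  - move=> a aS; rewrite (_ : [set _ in _ | _] = set0) ?cards0 //; apply/setP=> z.
    rewrite [LHS]inE in_set0; apply/negP=> /andP[]; rewrite inE => /andP[_ zT].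
    by rewrite (negbTE (noST a z aS zT)).
  by move: cT' m2; clear; move: #|_ :\ _|; lia.
pose O := ~: [set z in P].
have cP : #|[set z in P]| = p by rewrite cardsE (card_uniqP uP).
have cO : #|O| + p = #|F| by rewrite addnC -cP cardsC.
have OP (Q : {set F}) : Q \subset O -> {in Q, forall x, x \notin P}.
  by move=> /subsetP QO x /QO; rewrite !inE.
(* With fewer than [2 * m] vertices off [P], the bound on [n] for [m >= 6] makes [P] long. *)
have long : m <= 5 \/ 2 * m <= p.
  case: (leqP m 5) => m6; first by left.
  right.
  by move: near leF m6 (large m6); rewrite -cO; clear; move: #|O|; nia.
have /card_gt0P[v0 _] : 0 < #|F| by move: leF pn m2; clear; move: #|F| (size P); lia.
have cOm : m <= #|O| by move: leF pn cO m2; rewrite /p; clear; move: #|F| #|O| (size P); lia.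
have [lt|lt|eq] := ltngtP (2 * m) p.
- have [Q QO cQ] := subset_of_card cOm.
  exact: (jahangir_long_path v0 uP sP maxP m2 lt cQ (OP _ QO)).
- case: long => [m5|]; last by rewrite leqNgt lt.
  (* From [n >= 2 * m + 1] the graph has at least [3 * m] vertices. *)
  have le3 : 3 * m - p <= #|O|.
    by move: leF (small m5) cO; rewrite -/p; clear; move: #|F| #|O|; lia.
  have [Q QO cQ] := subset_of_card le3.
  have [eq1|ne1] := eqVneq p (2 * m).-1.
    apply: (jahangir_path_2m_minus_1 v0 uP sP maxP m2 eq1 _ (OP _ QO)).
    by rewrite cQ eq1; move: m2; clear; lia.
  apply: (jahangir_short_path v0 uP sP maxP _ _ _ _ (OP _ QO)); rewrite -?/p.
  - by rewrite m2.
  - by move: near leF (small m5); clear; move: #|F|; lia.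
  - by move: lt ne1; clear; lia.
  by rewrite cQ; move: lt; clear; lia.
have [Q QO cQ] := subset_of_card cOm.
exact: (jahangir_path_2m v0 uP sP maxP m2 (esym eq) cQ (OP _ QO)).
Qed.

Definition induced_adj (F : sgraph) (V : {set F}) : rel {x : F | x \in V} :=
  fun x y => adj (val x) (val y).

Lemma induced_adj_sym (F : sgraph) (V : {set F}) : symmetric (@induced_adj F V).
Proof. by move=> x y; apply: adj_sym. Qed.

Lemma induced_adj_irrefl (F : sgraph) (V : {set F}) : irreflexive (@induced_adj F V).
Proof. by move=> x; apply: adj_irrefl. Qed.

Definition induced (F : sgraph) (V : {set F}) : sgraph :=
  SGraph (@induced_adj_sym F V) (@induced_adj_irrefl F V).

Lemma contains_complement_induced (F H : sgraph) (V : {set F}) :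
  contains (complement (induced V)) H -> contains (complement F) H.
Proof.
case=> f injf adjf; exists (fun x => val (f x)); first by move=> x y /val_inj/injf.
by move=> x y /adjf.
Qed.

(** Working inside a vertex set [V] lets the induction on [k] delete the path just found. For
    [i < k] and [j < n], [g i j] is vertex [j] of path [i]. *)
Lemma disjoint_paths_or_jahangir (F : sgraph) k m n (V : {set F}) :
  2 < m -> (m <= 5 -> 2 * m + 1 <= n) -> (6 <= m -> (4 * m - 1) * (m - 1) + 1 <= n) ->
  k * n + m - 1 <= #|V| ->
  contains (complement F) (jahangir m) \/
  exists g : nat -> nat -> F,
    [/\ forall i j, i < k -> j < n -> g i j \in V,
        forall i j i' j', i < k -> j < n -> i' < k -> j' < n -> g i j = g i' j' -> i = i' /\ j = j'
      & forall i j, i < k -> j.+1 < n -> adj (g i j) (g i j.+1)].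
Proof.
move=> m2 small large; elim: k V => [|k IHk] V leV.
  have /card_gt0P[v0 _] : 0 < #|V| by move: leV m2; clear; move: #|V|; lia.
  by right; exists (fun _ _ => v0).
have [|[s [us ss zs]]|Jm] := @path_or_jahangir (induced V) m n m2 small large; last first.
- by left; apply: contains_complement_induced Jm.
- pose t := map val s.
  have ut : uniq t by rewrite map_inj_uniq //; apply: val_inj.
  have st : sorted (@adj F) t by rewrite sorted_map.
  have zt : size t = n by rewrite size_map.
  have tV x : x \in t -> x \in V by case/mapP=> y _ ->; apply: valP.
  have [|Jm|[g [gV ginj gadj]]] := IHk (V :\: [set x in t]).
  + have := cardsID [set x in t] V; rewrite (setIidPr _); last first.
      by apply/subsetP=> x; rewrite inE => /tV.
    rewrite cardsE (card_uniqP ut) zt; move: leV; clear.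
    by move: #|V| #|_ :\: _|; lia.
  + by left.
  have [x0 _|no0] := pickP (@predT F); last first.
    by right; exists g; split=> i j; have := no0 (g i j).
  right; exists (fun i j => if i == k then nth x0 t j else g i j); split.
  + move=> i j; rewrite ltnS => ik jn; have [_|ne] := eqVneq i k.
      by apply: tV; rewrite mem_nth ?zt.
    have ik' : i < k by rewrite ltn_neqAle ne.
    by have := gV i j ik' jn; rewrite inE => /andP[].
  + have out i j : i < k -> j < n -> g i j \notin t.
      by move=> ik jn; have := gV i j ik jn; rewrite !inE => /andP[].
    move=> i j i' j'; rewrite !ltnS => ik jn i'k j'n.
    have [->|ne] := eqVneq i k; have [->|ne'] := eqVneq i' k.
    * by move/eqP; rewrite nth_uniq ?zt // => /eqP.
    * move=> E; have i'k' : i' < k by rewrite ltn_neqAle ne'.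
      by have := out i' j' i'k' j'n; rewrite -E mem_nth ?zt.
    * move=> E; have ik' : i < k by rewrite ltn_neqAle ne.
      by have := out i j ik' jn; rewrite E mem_nth ?zt.
    * by apply: ginj; rewrite // ltn_neqAle ?ne ?ne'.
  move=> i j; rewrite ltnS => ik jn; have [_|ne] := eqVneq i k.
    by move/(sortedP x0): st; apply; rewrite zt.
  by apply: gadj; rewrite // ltn_neqAle ne.
rewrite card_sig; apply: leq_trans leV; rewrite mulSn; clear; lia.
Qed.

(** * Lower bound by two disjoint cliques *)

Lemma card_le_of_interval (T : finType) M (f : T -> 'I_M) a b :
  injective f -> (forall x, a <= f x < a + b) -> #|T| <= b.
Proof.
move=> injf rg; rewrite cardE -(size_map (fun x => f x : nat)) -[X in _ <= X](size_iota a).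
apply: uniq_leq_size; last by move=> i /mapP[x _ ->]; rewrite mem_iota.
by rewrite map_inj_uniq ?enum_uniq // => x y /val_inj/injf.
Qed.

Definition two_cliques_adj a M : rel 'I_M := fun x y => (x != y) && ((x < a) == (y < a)).

Lemma two_cliques_adj_sym a M : symmetric (@two_cliques_adj a M).
Proof. by move=> x y; rewrite /two_cliques_adj eq_sym [in X in _ && X]eq_sym. Qed.

Lemma two_cliques_adj_irrefl a M : irreflexive (@two_cliques_adj a M).
Proof. by move=> x; rewrite /two_cliques_adj eqxx. Qed.

Definition two_cliques a M : sgraph :=
  SGraph (@two_cliques_adj_sym a M) (@two_cliques_adj_irrefl a M).

(** Each path stays inside one clique. The clique with [b < n] vertices has no room for it, so all
    [k * n] vertices would lie in the other one. *)
Lemma two_cliques_no_paths a b k n :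
  b < n -> a < k * n -> ~ contains (two_cliques a (a + b)) (copies k (path_graph n)).
Proof.
move=> bn akn [f injf adjf].
have n0 : 0 < n by apply: leq_trans bn.
have side i j : (f (i, j) < a) = (f (i, Ordinal n0) < a).
  case: j => l; elim: l => [|l IHl] jn; first by congr (f (_, _) < a); apply: val_inj.
  rewrite -(IHl (ltnW jn)).
  have /adjf/andP[_ /eqP//] : @adj (copies k (path_graph n)) (i, Ordinal jn) (i, Ordinal (ltnW jn)).
  by rewrite /= /copies_adj /= eqxx /= /simple_rel /= eqxx orbT -val_eqE /= neq_ltn ltnSn orbT.
have inA i j : f (i, j) < a.
  rewrite side; apply: contraT; rewrite -leqNgt => ge.
  have : #|'I_n| <= b.
    apply: (@card_le_of_interval 'I_n _ (fun l => f (i, l)) a b).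
      by move=> l l' /injf[].
    by move=> l; rewrite ltn_ord andbT leqNgt side -leqNgt.
  by rewrite card_ord leqNgt bn.
have : #|{: 'I_k * 'I_n}| <= a.
  by apply: (@card_le_of_interval _ _ f 0 a) => // -[i j]; rewrite inA.
by rewrite card_prod !card_ord leqNgt akn.
Qed.

(** The complement is bipartite. The cycle edges from position [2 * j] to [2 * j + 1] form a
    matching of [m] edges, each with an end in the part with [b < m] vertices. *)
Lemma two_cliques_no_jahangir a b m :
  0 < m -> b < m -> ~ contains (complement (two_cliques a (a + b))) (jahangir m).
Proof.
move=> m0 bm [f injf adjf].
have l0 (j : 'I_m) : 2 * j < 2 * m by rewrite ltn_pmul2l.
have l1 (j : 'I_m) : (2 * j).+1 < 2 * m by have := ltn_ord j; lia.
pose x0 j : jahangir m := Some (Ordinal (l0 j)); pose x1 j : jahangir m := Some (Ordinal (l1 j)).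
have sep j : (f (x0 j) < a) != (f (x1 j) < a).
  have : @adj (jahangir m) (x0 j) (x1 j).
    have ne : Ordinal (l0 j) != Ordinal (l1 j) by rewrite -val_eqE /= neq_ltn ltnSn.
    apply/andP; split; first by apply/eqP=> -[/eqP]; rewrite ltn_eqF.
    apply/orP; left; apply/andP; split=> //; apply/orP; left.
    by rewrite -val_eqE /= modn_small.
  by move/adjf/andP=> [ne]; rewrite /= /two_cliques_adj ne.
pose g j := if f (x0 j) < a then f (x1 j) else f (x0 j).
have : #|'I_m| <= b.
  apply: (@card_le_of_interval _ _ g a b).
    move=> j j'; rewrite /g; case: ifP => _; case: ifP => _ /injf[] E; apply: val_inj => /=; lia.
  move=> j; rewrite /g ltn_ord andbT leqNgt; case: ifP (sep j) => [_|->] //=.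
by rewrite card_ord leqNgt bm.
Qed.

Theorem theorem3 (k m n : nat) (hk : 2 <= k) (hm : 3 <= m)
    (hn_small : m \in [:: 3; 4; 5] -> 2 * m + 1 <= n)
    (hn_large : 6 <= m -> (4 * m - 1) * (m - 1) + 1 <= n) :
  is_ramsey_number (copies k (path_graph n)) (jahangir m) (k * n + m - 1).
Proof.
have small : m <= 5 -> 2 * m + 1 <= n.
  by move=> m5; apply: hn_small; rewrite !inE; lia.
(* This ensures that the clique with at most [m - 1] vertices contains no path on [n] vertices. *)
have mn : m <= n.
  by have [m5|m6] := leqP m 5; [move: (small m5) | move: (hn_large m6)]; clear -hm; nia.
split.
  move=> F cF; have [|J|[g [_ ginj gadj]]] :=
    @disjoint_paths_or_jahangir F k m n setT hm small hn_large.
  - by rewrite cardsT cF.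
  - by right.
  left; exists (fun x : 'I_k * 'I_n => g x.1 x.2).
    move=> [i j] [i' j'] /= E.
    have [Ei Ej] := ginj _ _ _ _ (ltn_ord i) (ltn_ord j) (ltn_ord i') (ltn_ord j') E.
    by congr (_, _); apply: val_inj.
  move=> [i j] [i' j'] /andP[/eqP /= <-] /andP[_ /orP[] /eqP E]; last rewrite adj_sym.
    by rewrite -E; apply: gadj; rewrite ?E ltn_ord.
  by rewrite -E; apply: gadj; rewrite ?E ltn_ord.
move=> M ramM; rewrite leqNgt; apply/negP=> ltM.
(* Every [M] below the claimed value has to be refuted, not only the largest, so the first clique
   takes up to [k * n - 1] vertices and the second whatever is left. *)
have [a [b [EM bm akn]]] : exists a b, [/\ M = a + b, b < m & a < k * n].
  have kn0 : 0 < k * n by rewrite muln_gt0; lia.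
  exists (minn M (k * n - 1)), (M - (k * n - 1)); move: ltM kn0 hm; clear.
  by move: (k * n) => c; split; lia.
subst M; have [||] := ramM (two_cliques a (a + b)); first exact: card_ord.
  by apply: two_cliques_no_paths => //; apply: leq_trans mn.
by apply: two_cliques_no_jahangir => //; apply: leq_ltn_trans bm.
Qed.
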